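(* Let $f$ and $h$ be analytic in $\mathbb{D}=\{z\in\mathbb{C}:|z|<1\}$ and suppose that $f\prec h$ in $\mathbb{D}$. Then for every $k\in\{0,1,2,\dots\}$ the $k$-th sections of $f'$ and $h'$ satisfy, with $|z|=r$: (1) $|s_k(f')(z)|\le B_r(s_k(h'))$ for $0\le r\le\frac12\left(1-\sqrt{\frac23}\right)$; (2) $B_r(s_k(f'))\le B_r(s_k(h'))$ for $0\le r\le\frac13\left(1-\sqrt{\frac23}\right)$.
   Context: For $g(z)=\sum_{n=0}^{\infty}c_nz^n$ analytic in $\mathbb{D}$: the Bohr operator is $B_r(g)=\sum_{n=0}^{\infty}|c_n|r^n$ for $0\le r<1$, and the $k$-th section of $g$ is the polynomial $s_k(g)(z)=\sum_{n=0}^{k}c_nz^n$. A Schwarz function is an analytic function $\varphi:\mathbb{D}\to\mathbb{D}$ with $\varphi(0)=0$. The subordination $f\prec h$ in $\mathbb{D}$ means $f(z)=h(\varphi(z))$ for all $z\in\mathbb{D}$, for some Schwarz function $\varphi$. *)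

(* Defs.v *)
From Stdlib Require Import Reals Lra ClassicalEpsilon FunctionalExtensionality.
From Coquelicot Require Import Coquelicot.

Local Open Scope R_scope.

Definition unit_disc (z : C) : Prop := Cmod z < 1.

(* A function on the unit disc is represented by a total function C -> C; every
   notion below depends only on its values on the disc. *)

Definition analytic_on (U : C -> Prop) (g : C -> C) : Prop :=
  forall z0 : C, U z0 ->
    exists (c : nat -> C) (eps : R), 0 < eps /\
      forall w : C, Cmod w < eps -> is_pseries c w (g (z0 + w)%C).

Definition schwarz_function (phi : C -> C) : Prop :=
  analytic_on unit_disc phi /\
  (forall z : C, unit_disc z -> unit_disc (phi z)) /\
  phi (RtoC 0) = RtoC 0.

Definition subordinate (f h : C -> C) : Prop :=
  exists phi : C -> C, schwarz_function phi /\
    forall z : C, unit_disc z -> f z = h (phi z).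

Definition disc_expansion (c : nat -> C) (g : C -> C) : Prop :=
  forall z : C, unit_disc z -> is_pseries c z (g z).

(* The sequence c with g(z) = sum_n c_n z^n on the unit disc, meaningful when
   such a sequence exists; it is then unique by [coeff_unique] below. *)
Definition coeff (g : C -> C) : nat -> C :=
  epsilon (inhabits (fun _ : nat => RtoC 0)) (fun c => disc_expansion c g).

Definition bohr (r : R) (g : C -> C) : R :=
  Series (fun n => Cmod (coeff g n) * r ^ n).

Definition section (k : nat) (g : C -> C) (z : C) : C :=
  sum_n (fun n => (coeff g n * z ^ n)%C) k.

Lemma is_pseries_real_part (L : C -> R) (c : nat -> C) (x : R) (l : C) :
  L = fst \/ L = snd ->
  is_pseries c (RtoC x) l -> is_pseries (fun n => L (c n)) x (L l).
Proof.
intros HL H.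
assert (Hp : forall n, pow_n (K := C_AbsRing) (RtoC x) n = RtoC (x ^ n)).
{ induction n as [|n IH]; [reflexivity|].
  change (Cmult (RtoC x) (pow_n (K := C_AbsRing) (RtoC x) n) = RtoC (x * x ^ n)).
  now rewrite IH, RtoC_mult. }
assert (Hs : forall n,
  L (sum_n (fun k => scal (pow_n (K := C_AbsRing) (RtoC x) k) (c k)) n) =
  sum_n (fun k => scal (pow_n (K := R_AbsRing) x k) (L (c k))) n).
{ assert (Hscal : forall n,
    L (scal (pow_n (K := C_AbsRing) (RtoC x) n) (c n)) =
    scal (pow_n (K := R_AbsRing) x n) (L (c n))).
  { intros n.
    change (L (Cmult (pow_n (K := C_AbsRing) (RtoC x) n) (c n)) =
            pow_n (K := R_AbsRing) x n * L (c n)).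
    rewrite Hp, (pow_n_pow x n : pow_n (K := R_AbsRing) x n = x ^ n).
    destruct HL as [-> | ->]; simpl; ring. }
  induction n as [|n IH].
  - rewrite 2!sum_O. apply Hscal.
  - rewrite 2!sum_Sn.
    transitivity (Rplus
      (L (sum_n (fun k => scal (pow_n (K := C_AbsRing) (RtoC x) k) (c k)) n))
      (L (scal (pow_n (K := C_AbsRing) (RtoC x) (S n)) (c (S n))))).
    + destruct HL as [-> | ->]; reflexivity.
    + exact (f_equal2 Rplus IH (Hscal (S n))). }
refine (filterlim_ext _ _ Hs _).
eapply filterlim_comp; [exact H|].
intros P [e He]. exists e. intros y [Hy1 Hy2].
apply He. destruct HL as [-> | ->]; assumption.
Qed.

Lemma real_pseries_unique (a b : nat -> R) (g : R -> R) :
  (forall x, Rabs x < 1 -> is_pseries a x (g x)) ->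
  (forall x, Rabs x < 1 -> is_pseries b x (g x)) ->
  forall n, a n = b n.
Proof.
intros Ha Hb n.
assert (R0 : forall u : nat -> R,
  (forall x, Rabs x < 1 -> is_pseries u x (g x)) -> Rbar_lt 0 (CV_radius u)).
{ intros u Hu. destruct (Rbar_lt_le_dec 0 (CV_radius u)) as [|Hle]; [assumption|].
  exfalso. apply (CV_disk_outside u (/ 2)).
  - apply Rbar_le_lt_trans with (1 := Hle). simpl. rewrite Rabs_pos_eq; lra.
  - assert (Hh : ex_pseries u (/ 2)).
    { exists (g (/ 2)). apply Hu. rewrite Rabs_pos_eq; lra. }
    apply ex_pseries_R, ex_series_lim_0 in Hh. exact Hh. }
apply PSeries_ext_recip; auto.
exists (mkposreal 1 Rlt_0_1). intros x Hx.
assert (Hx1 : Rabs x < 1).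
{ change (Rabs (x - 0) < 1) in Hx. rewrite Rminus_0_r in Hx. exact Hx. }
rewrite (is_pseries_unique _ _ _ (Ha x Hx1)).
now rewrite (is_pseries_unique _ _ _ (Hb x Hx1)).
Qed.

Lemma coeff_unique (c : nat -> C) (g : C -> C) :
  disc_expansion c g -> coeff g = c.
Proof.
intros Hc.
assert (He : disc_expansion (coeff g) g).
{ unfold coeff. apply epsilon_spec. now exists c. }
apply functional_extensionality. intros n.
assert (HL : forall L : C -> R, L = fst \/ L = snd -> L (coeff g n) = L (c n)).
{ intros L HL.
  apply (real_pseries_unique (fun n => L (coeff g n)) (fun n => L (c n))
           (fun x => L (g (RtoC x)))); intros x Hx;
    apply is_pseries_real_part; trivial; [apply He | apply Hc];
    unfold unit_disc; now rewrite Cmod_R. }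
apply injective_projections; apply HL; auto.
Qed.

(* Main.v *)
Require Import Defs.
From Stdlib Require Import Reals Lra Lia Arith Classical ClassicalEpsilon.
From Coquelicot Require Import Coquelicot.

Local Open Scope R_scope.

(** Write [f = h o phi] with [phi] a Schwarz function, and let [a], [b] be the
    Taylor coefficients of [f], [h] at the origin.  Since [phi^n] vanishes to order
    [n] there, [a_l] is the sum over [n <= l] of [b_n] times the [l]-th coefficient
    of [phi^n], so everything reduces to [h(w) = w^n], that is, to bounding the
    majorant series of [(phi^n)'] by [n r^(n-1)].

    The function [phi^n] is bounded by 1 and its expansion starts with some
    [alpha z^n], so all its later coefficients are at most [2 (1 - |alpha|)] in
    modulus ([bounded_coefficients]).  As [n + m <= n (1 + m)], the majorant series
    of [(phi^n)'] is at most

      [n r^(n-1) (|alpha| + 2 (1 - |alpha|) (sum of (m + 1) r^m over m >= 1))],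

    and the last sum, [1 / (1 - r)^2 - 1], is at most [1/2] exactly when
    [r <= 1 - sqrt (2/3)] ([power_majorant], [subordinate_majorant]).  This gives
    [B_r (s_k (f')) <= B_r (s_k (h'))] on that whole range, which contains both
    ranges of the theorem; claim (1) follows because [|s_k (f') (z)|] is at most
    [B_r (s_k (f'))] for [|z| = r].

    The function theory behind this is that a function with local power series at
    every point of the disc has a derivative given, on the whole disc, by the
    termwise derivative of its Taylor series at the origin.  It is obtained without
    integration, from a maximum principle.  An interior maximum of
    [|g|^2 + e |z|^2] is impossible because the mean of [g] over four equidistant
    points of a small circle equals the value at the centre up to third order
    ([no_interior_max]).  Averaging [g] over rotations by roots of unity isolates a
    coefficient, and dividing by the power of [z] in front of it turns the maximum
    principle into Cauchy's estimate ([cauchy_estimate]).  Dividing the Taylor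
    remainder of order [k] by [z^k] turns it into geometric decay of the remainders
    ([remainder_bound]), and Cauchy's estimate for the first coefficient of
    a remainder then gives termwise differentiation ([derive_disc_expansion]). *)

(** * Finite sums and polynomials *)

(** Sums indexed by their number of terms, so that the empty sum is available; the
    sums [sum_n] of the statement always have at least one term. *)
Fixpoint csum (F : nat -> C) (n : nat) : C :=
  match n with
  | O => RtoC 0
  | S m => (csum F m + F m)%C
  end.

Fixpoint rsum (F : nat -> R) (n : nat) : R :=
  match n with
  | O => 0
  | S m => rsum F m + F m
  end.

Definition jet (c : nat -> C) (n : nat) (w : C) : C :=
  csum (fun l => (c l * w ^ l)%C) n.

Lemma csum_ext (F G : nat -> C) (n : nat) :
  (forall l, (l < n)%nat -> F l = G l) -> csum F n = csum G n.
Proof.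
induction n as [|n IH]; intros H; simpl; [reflexivity|].
rewrite IH by (intros; apply H; lia). rewrite (H n) by lia. reflexivity.
Qed.

Lemma csum_plus (F G : nat -> C) (n : nat) :
  csum (fun l => (F l + G l)%C) n = (csum F n + csum G n)%C.
Proof. induction n as [|n IH]; simpl; [|rewrite IH]; ring. Qed.

Lemma csum_scal (a : C) (F : nat -> C) (n : nat) :
  csum (fun l => (a * F l)%C) n = (a * csum F n)%C.
Proof. induction n as [|n IH]; simpl; [|rewrite IH]; ring. Qed.

Lemma csum_zero (F : nat -> C) (n : nat) :
  (forall l, (l < n)%nat -> F l = RtoC 0) -> csum F n = RtoC 0.
Proof.
induction n as [|n IH]; intros H; simpl; [reflexivity|].
rewrite IH by (intros; apply H; lia). rewrite (H n) by lia. ring.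
Qed.

Lemma csum_single (F : nat -> C) (n m : nat) :
  (m < n)%nat -> (forall l, (l < n)%nat -> l <> m -> F l = RtoC 0) ->
  csum F n = F m.
Proof.
induction n as [|n IH]; intros Hm H; [lia|]; simpl.
destruct (Nat.eq_dec m n) as [->|Hne].
- rewrite csum_zero by (intros; apply H; lia). ring.
- rewrite IH by (try lia; intros; apply H; lia). rewrite (H n) by lia. ring.
Qed.

Lemma csum_const (a : C) (n : nat) : csum (fun _ => a) n = (RtoC (INR n) * a)%C.
Proof.
induction n as [|n IH]; [simpl; ring|].
rewrite S_INR, RtoC_plus. simpl csum. rewrite IH. ring.
Qed.

Lemma csum_swap (F : nat -> nat -> C) (n m : nat) :
  csum (fun i => csum (fun j => F i j) m) n =
  csum (fun j => csum (fun i => F i j) n) m.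
Proof.
induction n as [|n IH]; simpl.
- now rewrite csum_zero.
- now rewrite IH, <- csum_plus.
Qed.

Lemma csum_first (F : nat -> C) (n : nat) :
  csum F (S n) = (F O + csum (fun l => F (S l)) n)%C.
Proof.
induction n as [|n IH]; [simpl; ring|].
change (csum F (S (S n))) with (csum F (S n) + F (S n))%C.
rewrite IH. simpl. ring.
Qed.

Lemma Cmod_csum (F : nat -> C) (n : nat) :
  Cmod (csum F n) <= rsum (fun l => Cmod (F l)) n.
Proof.
induction n as [|n IH]; simpl.
- rewrite Cmod_0. lra.
- eapply Rle_trans; [apply Cmod_triangle|]. lra.
Qed.

Lemma rsum_le (F G : nat -> R) (n : nat) :
  (forall l, (l < n)%nat -> F l <= G l) -> rsum F n <= rsum G n.
Proof.
induction n as [|n IH]; intros H; simpl; [lra|].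
specialize (H n ltac:(lia)) as Hn. specialize (IH ltac:(intros; apply H; lia)).
lra.
Qed.

Lemma rsum_plus (F G : nat -> R) (n : nat) :
  rsum (fun l => F l + G l) n = rsum F n + rsum G n.
Proof. induction n as [|n IH]; simpl; [|rewrite IH]; ring. Qed.

Lemma rsum_scal (a : R) (F : nat -> R) (n : nat) :
  rsum (fun l => a * F l) n = a * rsum F n.
Proof. induction n as [|n IH]; simpl; [|rewrite IH]; ring. Qed.

Lemma rsum_ext (F G : nat -> R) (n : nat) :
  (forall l, (l < n)%nat -> F l = G l) -> rsum F n = rsum G n.
Proof.
intros H. apply Rle_antisym; apply rsum_le; intros l Hl; rewrite (H l Hl); lra.
Qed.

Lemma rsum_const (a : R) (n : nat) : rsum (fun _ => a) n = INR n * a.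
Proof.
induction n as [|n IH]; [simpl; ring|].
rewrite S_INR. simpl rsum. rewrite IH. ring.
Qed.

Lemma rsum_swap (F : nat -> nat -> R) (n m : nat) :
  rsum (fun i => rsum (fun j => F i j) m) n =
  rsum (fun j => rsum (fun i => F i j) n) m.
Proof.
induction n as [|n IH]; simpl.
- rewrite rsum_const. ring.
- now rewrite IH, <- rsum_plus.
Qed.

Lemma rsum_split (F : nat -> R) (m n : nat) :
  rsum F (m + n) = rsum F m + rsum (fun l => F (m + l)%nat) n.
Proof.
induction n as [|n IH]; [rewrite Nat.add_0_r; simpl; ring|].
rewrite Nat.add_succ_r. simpl. rewrite IH. ring.
Qed.

Lemma geometric_rsum_le (q : R) (n : nat) :
  0 <= q < 1 -> rsum (fun l => q ^ l) n <= / (1 - q).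
Proof.
intros Hq.
assert (E : (1 - q) * rsum (fun l => q ^ l) n = 1 - q ^ n).
{ induction n as [|n IH]; simpl; [ring|]. rewrite Rmult_plus_distr_l, IH. ring. }
assert (0 <= q ^ n) by (apply pow_le; lra).
apply Rmult_le_reg_l with (1 - q); [lra|]. rewrite E, Rinv_r; lra.
Qed.

Lemma jet_S (c : nat -> C) (n : nat) (w : C) :
  jet c (S n) w = (jet c n w + c n * w ^ n)%C.
Proof. reflexivity. Qed.

Lemma jet_first (c : nat -> C) (n : nat) (w : C) :
  jet c (S n) w = (c O + w * jet (fun l => c (S l)) n w)%C.
Proof.
unfold jet. rewrite csum_first, <- csum_scal. simpl. rewrite Cmult_1_r. f_equal.
apply csum_ext. intros. ring.
Qed.

Lemma jet_ext (c d : nat -> C) (n : nat) (w : C) :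
  (forall l, (l < n)%nat -> c l = d l) -> jet c n w = jet d n w.
Proof. intros H. apply csum_ext. intros l Hl. now rewrite H. Qed.

Lemma jet_plus (c d : nat -> C) (n : nat) (w : C) :
  jet (fun l => (c l + d l)%C) n w = (jet c n w + jet d n w)%C.
Proof. unfold jet. rewrite <- csum_plus. apply csum_ext. intros; ring. Qed.

Lemma jet_scal (a : C) (c : nat -> C) (n : nat) (w : C) :
  jet (fun l => (a * c l)%C) n w = (a * jet c n w)%C.
Proof. unfold jet. rewrite <- csum_scal. apply csum_ext. intros; ring. Qed.

Lemma jet_rotate (u : C) (c : nat -> C) (n : nat) (w : C) :
  jet (fun l => (c l * u ^ l)%C) n w = jet c n (u * w)%C.
Proof. unfold jet. apply csum_ext. intros. rewrite Cpow_mult_l. ring. Qed.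

Lemma jet_0 (c : nat -> C) (n : nat) : jet c (S n) (RtoC 0) = c O.
Proof. rewrite jet_first. ring. Qed.

Lemma Cmod_minus_sym (a b : C) : Cmod (a - b) = Cmod (b - a).
Proof. rewrite <- Cmod_opp. f_equal. ring. Qed.

Lemma Cmod_triangle_minus (a b : C) : Cmod (a - b) <= Cmod a + Cmod b.
Proof. rewrite <- (Cmod_opp b). apply Cmod_triangle. Qed.

Lemma Cmod_jet_le (c : nat -> C) (n : nat) (w : C) :
  Cmod (jet c n w) <= rsum (fun l => Cmod (c l) * Cmod w ^ l) n.
Proof.
eapply Rle_trans; [apply Cmod_csum|]. apply Req_le, rsum_ext.
intros. now rewrite Cmod_mult, Cmod_pow.
Qed.

(** * Taylor approximation at the origin *)

(** Taylor approximation to a fixed order, with error [O(w^n)].  Working order by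
    order makes products, compositions and divisions by the variable a matter of
    finite algebra, with no convergence to control. *)
Definition has_jet (n : nat) (c : nat -> C) (g : C -> C) : Prop :=
  exists K d : R, 0 <= K /\ 0 < d /\
    forall w : C, Cmod w < d -> Cmod (g w - jet c n w) <= K * Cmod w ^ n.

Lemma has_jet_pred (n : nat) (c : nat -> C) (g : C -> C) :
  has_jet (S n) c g -> has_jet n c g.
Proof.
intros (K & d & HK & Hd & H).
exists (K * d + Cmod (c n)), d.
assert (Hc := Cmod_ge_0 (c n)). repeat split; [nra|exact Hd|].
intros w Hw. specialize (H w Hw). rewrite jet_S in H.
replace (g w - jet c n w)%C
  with ((g w - (jet c n w + c n * w ^ n)) + c n * w ^ n)%C by ring.
eapply Rle_trans; [apply Cmod_triangle|].
rewrite Cmod_mult, Cmod_pow. simpl in H.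
assert (H0 := Cmod_ge_0 w). assert (Hp := pow_le _ n H0).
assert (K * (Cmod w * Cmod w ^ n) <= K * (d * Cmod w ^ n)).
{ apply Rmult_le_compat_l; [exact HK|]. apply Rmult_le_compat_r; lra. }
nra.
Qed.

Lemma has_jet_local (n : nat) (c : nat -> C) (f g : C -> C) (r : R) :
  0 < r -> (forall w, Cmod w < r -> f w = g w) -> has_jet n c f -> has_jet n c g.
Proof.
intros Hr E (K & d & HK & Hd & H).
exists K, (Rmin d r). repeat split; [exact HK|now apply Rmin_pos|].
intros w Hw. rewrite <- E.
- apply H. eapply Rlt_le_trans; [exact Hw|apply Rmin_l].
- eapply Rlt_le_trans; [exact Hw|apply Rmin_r].
Qed.

Lemma has_jet_ext (n : nat) (c d : nat -> C) (f g : C -> C) :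
  (forall l, (l < n)%nat -> c l = d l) -> (forall w, f w = g w) ->
  has_jet n c f -> has_jet n d g.
Proof.
intros Hcd E (K & r & HK & Hr & H).
exists K, r. repeat split; auto. intros w Hw.
rewrite <- E, <- (jet_ext c d) by exact Hcd. now apply H.
Qed.

Lemma has_jet_plus (n : nat) (c d : nat -> C) (f g : C -> C) :
  has_jet n c f -> has_jet n d g ->
  has_jet n (fun l => (c l + d l)%C) (fun w => (f w + g w)%C).
Proof.
intros (K & r & HK & Hr & H) (K' & r' & HK' & Hr' & H').
exists (K + K'), (Rmin r r'). repeat split; [lra|now apply Rmin_pos|].
intros w Hw. rewrite jet_plus.
replace (f w + g w - (jet c n w + jet d n w))%C
  with ((f w - jet c n w) + (g w - jet d n w))%C by ring.
eapply Rle_trans; [apply Cmod_triangle|].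
rewrite Rmult_plus_distr_r. apply Rplus_le_compat.
- apply H. eapply Rlt_le_trans; [exact Hw|apply Rmin_l].
- apply H'. eapply Rlt_le_trans; [exact Hw|apply Rmin_r].
Qed.

Lemma has_jet_scal (n : nat) (a : C) (c : nat -> C) (f : C -> C) :
  has_jet n c f -> has_jet n (fun l => (a * c l)%C) (fun w => (a * f w)%C).
Proof.
intros (K & r & HK & Hr & H).
exists (Cmod a * K), r. assert (Ha := Cmod_ge_0 a).
repeat split; [nra|exact Hr|].
intros w Hw. rewrite jet_scal.
replace (a * f w - a * jet c n w)%C with (a * (f w - jet c n w))%C by ring.
rewrite Cmod_mult, Rmult_assoc. apply Rmult_le_compat_l; auto.
Qed.

Lemma has_jet_zero (n : nat) : has_jet n (fun _ => RtoC 0) (fun _ => RtoC 0).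
Proof.
exists 0, 1. repeat split; try lra. intros w _.
replace (jet _ n w) with (RtoC 0).
- replace (0 - 0)%C with (RtoC 0) by ring. rewrite Cmod_0. lra.
- symmetry. apply csum_zero. intros. ring.
Qed.

Lemma has_jet_csum (n m : nat) (c : nat -> nat -> C) (f : nat -> C -> C) :
  (forall i, (i < m)%nat -> has_jet n (c i) (f i)) ->
  has_jet n (fun l => csum (fun i => c i l) m) (fun w => csum (fun i => f i w) m).
Proof.
induction m as [|m IH]; intros H; simpl; [apply has_jet_zero|].
apply has_jet_plus; [apply IH; intros; apply H; lia|apply H; lia].
Qed.

Lemma has_jet_rotate (n : nat) (u : C) (c : nat -> C) (f : C -> C) :
  Cmod u = 1 -> has_jet n c f ->
  has_jet n (fun l => (c l * u ^ l)%C) (fun w => f (u * w)%C).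
Proof.
intros Hu (K & r & HK & Hr & H). exists K, r. repeat split; auto.
intros w Hw. rewrite jet_rotate.
assert (E : Cmod (u * w) = Cmod w) by (rewrite Cmod_mult, Hu; ring).
rewrite <- E. apply H. now rewrite E.
Qed.

Lemma has_jet_value (n : nat) (c : nat -> C) (g : C -> C) :
  has_jet (S n) c g -> g (RtoC 0) = c O.
Proof.
intros (K & d & HK & Hd & H). specialize (H (RtoC 0)).
rewrite jet_0, Cmod_0 in H. specialize (H Hd). simpl in H.
apply Ceq_minus, Cmod_eq_0. assert (A := Cmod_ge_0 (g (RtoC 0) - c O)). lra.
Qed.

(** The difference quotient at the origin; its value there is prescribed, because
    the functions at hand are not yet known to be differentiable. *)
Definition quot (g : C -> C) (a : C) (w : C) : C :=
  if excluded_middle_informative (w = RtoC 0) then a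
  else ((g w - g (RtoC 0)) / w)%C.

Lemma quot_eq (g : C -> C) (a w : C) : g w = (g (RtoC 0) + w * quot g a w)%C.
Proof.
unfold quot. destruct (excluded_middle_informative (w = RtoC 0)) as [->|Hw].
- ring.
- field. exact Hw.
Qed.

Lemma has_jet_quot (n : nat) (c : nat -> C) (g : C -> C) :
  has_jet (S n) c g -> has_jet n (fun l => c (S l)) (quot g (c 1%nat)).
Proof.
intros Hg. assert (H0 := has_jet_value _ _ _ Hg).
destruct Hg as (K & d & HK & Hd & H).
exists (K + Cmod (c 1%nat)), d. assert (Hc := Cmod_ge_0 (c 1%nat)).
repeat split; [lra|exact Hd|]. intros w Hw. specialize (H w Hw).
destruct (classic (w = RtoC 0)) as [->|Hw0].
- unfold quot. destruct (excluded_middle_informative _) as [_|A]; [|now elim A].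
  destruct n as [|n].
  + simpl. unfold jet, csum. replace (c 1%nat - 0)%C with (c 1%nat) by ring. lra.
  + rewrite jet_0, Cmod_0. unfold Cminus. rewrite Cplus_opp_r, Cmod_0. simpl. lra.
- apply Rle_trans with (K * Cmod w ^ n).
  + rewrite (quot_eq g (c 1%nat) w), jet_first, H0 in H.
    set (q := quot g (c 1%nat) w) in *.
    set (j := jet _ n w) in *.
    replace (c O + w * q - (c O + w * j))%C with (w * (q - j))%C in H by ring.
    rewrite Cmod_mult in H. apply Cmod_gt_0 in Hw0.
    apply Rmult_le_reg_l with (1 := Hw0). simpl in H. lra.
  + apply Rmult_le_compat_r; [apply pow_le, Cmod_ge_0|lra].
Qed.

Lemma has_jet_cons (n : nat) (c : nat -> C) (g q : C -> C) :
  (forall w, g w = (c O + w * q w)%C) -> has_jet n (fun l => c (S l)) q ->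
  has_jet (S n) c g.
Proof.
intros E (K & d & HK & Hd & H). exists K, d. repeat split; auto.
intros w Hw. rewrite E, jet_first.
replace (c O + w * q w - (c O + w * jet (fun l => c (S l)) n w))%C
  with (w * (q w - jet (fun l => c (S l)) n w))%C by ring.
rewrite Cmod_mult. simpl. specialize (H w Hw). assert (A := Cmod_ge_0 w).
apply Rle_trans with (Cmod w * (K * Cmod w ^ n)); [|lra].
now apply Rmult_le_compat_l.
Qed.

(** Cauchy product of coefficient sequences, by recursion on the first factor to
    match the factorisation [g w = a 0 + w * q w]. *)
Fixpoint conv (a b : nat -> C) (n : nat) : C :=
  match n with
  | O => (a O * b O)%C
  | S m => (a O * b (S m) + conv (fun l => a (S l)) b m)%C
  end.

(** With [g w = a 0 + w * q w], the product is [a 0 * h + w * (q * h)], and [q]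
    needs one order less: induction on the order. *)
Lemma has_jet_mult (n : nat) (a b : nat -> C) (g h : C -> C) :
  has_jet n a g -> has_jet n b h -> has_jet n (conv a b) (fun w => (g w * h w)%C).
Proof.
revert a g. induction n as [|n IH]; intros a g Ha Hb.
- destruct Ha as (K & d & HK & Hd & H), Hb as (K' & d' & HK' & Hd' & H').
  exists (K * K'), (Rmin d d').
  repeat split; [nra|now apply Rmin_pos|]. intros w Hw.
  specialize (H w ltac:(eapply Rlt_le_trans; [exact Hw|apply Rmin_l])).
  specialize (H' w ltac:(eapply Rlt_le_trans; [exact Hw|apply Rmin_r])).
  unfold jet, csum in *. unfold Cminus in *.
  rewrite Copp_0, Cplus_0_r in *. simpl in *. rewrite Cmod_mult.
  rewrite !Rmult_1_r in *.
  apply Rmult_le_compat; auto using Cmod_ge_0.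
- assert (H0 := has_jet_value _ _ _ Ha).
  assert (Hq := IH _ _ (has_jet_quot _ _ _ Ha) (has_jet_pred _ _ _ Hb)).
  set (q := quot g (a 1%nat)) in *.
  assert (Hs : has_jet (S n)
    (fun l => match l with O => RtoC 0 | S m => conv (fun l => a (S l)) b m end)
    (fun w => (w * (q w * h w))%C)).
  { apply has_jet_cons with (2 := Hq). intros w. cbv beta iota. ring. }
  eapply has_jet_ext; [| |exact (has_jet_plus _ _ _ _ _ (has_jet_scal _ (a O) _ _ Hb) Hs)].
  + intros [|l] _; [simpl; ring|reflexivity].
  + intros w. rewrite (quot_eq g (a 1%nat) w). fold q. rewrite H0. ring.
Qed.

Lemma small_is_zero (x K d : R) :
  0 < d -> (forall s, 0 < s < d -> x <= K * s) -> x <= 0.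
Proof.
intros Hd H. apply Rnot_lt_le. intros Hx.
assert (HK : 0 < K).
{ specialize (H (d / 2) ltac:(lra)). apply Rnot_le_lt. intros A. nra. }
assert (Hm : 0 < Rmin (d / 2) (x / (2 * K))).
{ apply Rmin_pos; [lra|]. apply Rdiv_lt_0_compat; lra. }
specialize (H (Rmin (d / 2) (x / (2 * K)))).
assert (A := Rmin_l (d / 2) (x / (2 * K))). assert (B := Rmin_r (d / 2) (x / (2 * K))).
specialize (H ltac:(lra)).
assert (C : K * Rmin (d / 2) (x / (2 * K)) <= K * (x / (2 * K))) by (apply Rmult_le_compat_l; lra).
replace (K * (x / (2 * K))) with (x / 2) in C by (field; lra). lra.
Qed.

(** The lowest nonzero term of a polynomial dominates near the origin. *)
Lemma jet_small (n : nat) (c : nat -> C) (K d : R) :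
  0 < d -> 0 <= K ->
  (forall s, 0 < s < d -> Cmod (jet c n (RtoC s)) <= K * s ^ n) ->
  forall l, (l < n)%nat -> c l = RtoC 0.
Proof.
intros Hd HK. revert c K HK. induction n as [|n IH]; intros c K HK H l Hl; [lia|].
assert (Hb : 0 <= rsum (fun l => Cmod (c (S l)) * d ^ l) n).
{ rewrite <- (Rmult_0_r (INR n)), <- rsum_const. apply rsum_le. intros.
  apply Rmult_le_pos; [apply Cmod_ge_0|apply pow_le; lra]. }
set (B := rsum _ n) in Hb.
assert (Hc0 : c O = RtoC 0).
{ apply Cmod_eq_0. apply Rle_antisym; [|apply Cmod_ge_0].
  apply small_is_zero with (B + K * d ^ n) d; [exact Hd|]. intros s Hs.
  specialize (H s Hs). rewrite jet_first in H.
  set (j := jet _ n (RtoC s)) in H.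
  replace (c O) with ((c O + RtoC s * j) - RtoC s * j)%C by ring.
  eapply Rle_trans; [apply Cmod_triangle_minus|].
  rewrite Cmod_mult, Cmod_R, Rabs_pos_eq by lra.
  assert (Hj : Cmod j <= B).
  { unfold j, B. eapply Rle_trans; [apply Cmod_jet_le|]. apply rsum_le. intros i Hi.
    rewrite Cmod_R, Rabs_pos_eq by lra.
    apply Rmult_le_compat_l; [apply Cmod_ge_0|]. apply pow_incr; lra. }
  assert (Hp : s ^ n <= d ^ n) by (apply pow_incr; lra). simpl in H.
  assert (K * (s * s ^ n) <= K * (s * d ^ n)).
  { apply Rmult_le_compat_l; [exact HK|]. apply Rmult_le_compat_l; lra. }
  nra. }
destruct l as [|l]; [exact Hc0|].
apply (IH (fun l => c (S l)) K HK); [|lia]. intros s Hs.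
specialize (H s Hs). rewrite jet_first, Hc0, Cplus_0_l, Cmod_mult, Cmod_R in H.
rewrite Rabs_pos_eq in H by lra. simpl in H.
apply Rmult_le_reg_l with s; [lra|]. lra.
Qed.

Lemma has_jet_unique (n : nat) (c d : nat -> C) (g : C -> C) :
  has_jet n c g -> has_jet n d g -> forall l, (l < n)%nat -> c l = d l.
Proof.
intros (K & r & HK & Hr & H) (K' & r' & HK' & Hr' & H') l Hl.
apply Ceq_minus. revert l Hl.
apply (jet_small n (fun l => (c l - d l)%C) (K + K') (Rmin r r'));
  [now apply Rmin_pos|lra|].
intros s Hs.
assert (A := Rmin_l r r'). assert (B := Rmin_r r r').
assert (E : Cmod (RtoC s) = s) by (rewrite Cmod_R, Rabs_pos_eq; lra).
specialize (H (RtoC s)). specialize (H' (RtoC s)). rewrite E in H, H'.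
specialize (H ltac:(lra)). specialize (H' ltac:(lra)).
replace (jet (fun l => (c l - d l)%C) n (RtoC s))
  with ((g (RtoC s) - jet d n (RtoC s)) - (g (RtoC s) - jet c n (RtoC s)))%C.
- eapply Rle_trans; [apply Cmod_triangle_minus|]. lra.
- replace (jet (fun l => (c l - d l)%C) n (RtoC s))
    with (jet (fun l => (c l + (RtoC (-1)) * d l)%C) n (RtoC s)).
  + rewrite jet_plus, jet_scal. ring.
  + apply jet_ext. intros. ring.
Qed.

Definition taylor (c : nat -> C) (g : C -> C) : Prop := forall n, has_jet n c g.

(** Having Taylor approximations of all orders.  This follows from having a local
    power series, is visibly stable under algebraic operations, and is all that the
    maximum principle asks for. *)
Definition expandable_at (g : C -> C) (z : C) : Prop :=
  exists c, taylor c (fun w => g (z + w)%C).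

Definition expandable_on (r : R) (g : C -> C) : Prop :=
  forall z, Cmod z <= r -> expandable_at g z.

Lemma taylor_value (c : nat -> C) (g : C -> C) : taylor c g -> g (RtoC 0) = c O.
Proof. intros H. exact (has_jet_value 0 _ _ (H 1%nat)). Qed.

Lemma taylor_const (a : C) :
  taylor (fun l => match l with O => a | S _ => RtoC 0 end) (fun _ => a).
Proof.
intros [|n].
- exists (Cmod a), 1. repeat split; [apply Cmod_ge_0|lra|]. intros w _.
  unfold jet, csum. replace (a - 0)%C with a by ring. simpl. lra.
- eapply has_jet_cons with (q := fun _ => RtoC 0); [intros; ring|]. apply has_jet_zero.
Qed.

Lemma taylor_id (z : C) :
  taylor (fun l => match l with O => z | 1%nat => RtoC 1 | _ => RtoC 0 end)
    (fun w => (z + w)%C).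
Proof.
intros n. apply has_jet_pred. eapply has_jet_cons with (q := fun _ => RtoC 1).
- intros. ring.
- eapply has_jet_ext; [| |exact (taylor_const 1 n)]; [intros [|l]|]; reflexivity.
Qed.

Lemma taylor_mult (a b : nat -> C) (g h : C -> C) :
  taylor a g -> taylor b h -> taylor (conv a b) (fun w => (g w * h w)%C).
Proof. intros Ha Hb n. now apply has_jet_mult. Qed.

Lemma taylor_inv (z : C) :
  z <> RtoC 0 -> taylor (fun l => (/ z * (- / z) ^ l)%C) (fun w => (/ (z + w))%C).
Proof.
intros Hz n.
assert (Hm : 0 < Cmod z) by now apply Cmod_gt_0.
exists (2 / Cmod z * (/ Cmod z) ^ n), (Cmod z / 2).
assert (H1 : 0 < / Cmod z) by now apply Rinv_0_lt_compat.
assert (H2 := pow_lt _ n H1).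
repeat split; [apply Rmult_le_pos; lra|lra|]. intros w Hw.
assert (Hl : Cmod z / 2 <= Cmod (z + w)).
{ assert (A := Cmod_triangle_minus (z + w) w).
  replace (z + w - w)%C with z in A by ring. lra. }
assert (Hn : (z + w)%C <> RtoC 0) by (apply Cmod_gt_0; lra).
assert (E : forall m, ((z + w) * jet (fun l => / z * (- / z) ^ l)%C m w
  = 1 - (- / z * w) ^ m)%C).
{ induction m as [|m IH]; [unfold jet; simpl; ring|].
  rewrite jet_S, Cmult_plus_distr_l, IH, !Cpow_mult_l, !Cpow_S. field. exact Hz. }
replace (/ (z + w) - jet (fun l => / z * (- / z) ^ l)%C n w)%C
  with (/ (z + w) * (- / z * w) ^ n)%C.
- rewrite Cmod_mult, Cmod_inv, Cmod_pow, Cmod_mult, Cmod_opp, Cmod_inv by assumption.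
  rewrite Rpow_mult_distr, <- Rmult_assoc.
  apply Rmult_le_compat_r; [apply pow_le, Cmod_ge_0|].
  apply Rmult_le_compat_r; [lra|].
  replace (2 / Cmod z) with (/ (Cmod z / 2)) by (field; lra).
  apply Rinv_le_contravar; lra.
- replace ((- / z * w) ^ n)%C with (1 - (1 - (- / z * w) ^ n))%C by ring.
  rewrite <- E. field. exact Hn.
Qed.

Lemma expandable_const (a z : C) : expandable_at (fun _ => a) z.
Proof. eexists. apply taylor_const. Qed.

Lemma expandable_id (z : C) : expandable_at (fun w => w) z.
Proof. eexists. apply taylor_id. Qed.

Lemma expandable_plus (f g : C -> C) (z : C) :
  expandable_at f z -> expandable_at g z -> expandable_at (fun w => (f w + g w)%C) z.
Proof.
intros [c Hc] [d Hd]. eexists. intros n. apply (has_jet_plus n c d); auto.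
Qed.

Lemma expandable_mult (f g : C -> C) (z : C) :
  expandable_at f z -> expandable_at g z -> expandable_at (fun w => (f w * g w)%C) z.
Proof.
intros [c Hc] [d Hd]. exists (conv c d). now apply taylor_mult.
Qed.

Lemma expandable_pow (f : C -> C) (n : nat) (z : C) :
  expandable_at f z -> expandable_at (fun w => (f w ^ n)%C) z.
Proof.
intros H. induction n as [|n IH]; [exact (expandable_const (RtoC 1) z)|].
exact (expandable_mult _ _ _ H IH).
Qed.

Lemma expandable_csum (f : nat -> C -> C) (n : nat) (z : C) :
  (forall i, (i < n)%nat -> expandable_at (f i) z) ->
  expandable_at (fun w => csum (fun i => f i w) n) z.
Proof.
induction n as [|n IH]; intros H; simpl; [apply expandable_const|].
apply expandable_plus; [apply IH; intros; apply H; lia|apply H; lia].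
Qed.

Lemma expandable_local (f g : C -> C) (z : C) (r : R) :
  0 < r -> (forall w, Cmod w < r -> f (z + w)%C = g (z + w)%C) ->
  expandable_at f z -> expandable_at g z.
Proof.
intros Hr E [c Hc]. exists c. intros n.
eapply has_jet_local with (1 := Hr) (2 := E). apply Hc.
Qed.

Lemma expandable_rotate (f : C -> C) (u z : C) :
  Cmod u = 1 -> expandable_at f (u * z)%C -> expandable_at (fun w => f (u * w)%C) z.
Proof.
intros Hu [c Hc]. eexists. intros n.
eapply has_jet_ext; [| |exact (has_jet_rotate n u c _ Hu (Hc n))].
- reflexivity.
- intros w. cbv beta. f_equal. ring.
Qed.

Lemma expandable_shift (f : C -> C) (a z : C) :
  expandable_at f (a + z)%C -> expandable_at (fun w => f (a + w)%C) z.
Proof.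
intros [c Hc]. exists c. intros n.
eapply has_jet_ext; [reflexivity| |apply Hc]. intros w. cbv beta. f_equal. ring.
Qed.

Lemma expandable_inv (z : C) : z <> RtoC 0 -> expandable_at Cinv z.
Proof. intros Hz. eexists. apply taylor_inv, Hz. Qed.

Lemma expandable_jet (c : nat -> C) (n : nat) (z : C) : expandable_at (jet c n) z.
Proof.
apply expandable_csum. intros l _.
apply expandable_mult; [apply expandable_const|apply expandable_pow, expandable_id].
Qed.

Lemma taylor_quot (c : nat -> C) (g : C -> C) :
  taylor c g -> taylor (fun l => c (S l)) (quot g (c 1%nat)).
Proof. intros H n. apply has_jet_quot, H. Qed.

Lemma taylor_at_0 (c : nat -> C) (g : C -> C) :
  taylor c g <-> taylor c (fun w => g (0 + w)%C).
Proof.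
split; intros H n; (eapply has_jet_ext; [reflexivity| |apply H]); intros w;
  cbv beta; now rewrite Cplus_0_l.
Qed.

(** Division by the variable costs nothing: at the origin the Taylor coefficients
    are shifted, elsewhere [1 / z] is itself expandable. *)
Lemma expandable_quot (r : R) (c : nat -> C) (g : C -> C) :
  expandable_on r g -> taylor c g -> expandable_on r (quot g (c 1%nat)).
Proof.
intros Hg Hc z Hz. destruct (classic (z = RtoC 0)) as [->|Hz0].
- exists (fun l => c (S l)). now apply (proj1 (taylor_at_0 _ _)), taylor_quot.
- apply (expandable_local (fun w => ((g w + - g (RtoC 0)) * / w)%C) _ z (Cmod z)).
  + now apply Cmod_gt_0.
  + intros w Hw. unfold quot. destruct (excluded_middle_informative _) as [A|_].
    * exfalso. replace w with (z + w - z)%C in Hw by ring. rewrite A in Hw.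
      replace (0 - z)%C with (- z)%C in Hw by ring. rewrite Cmod_opp in Hw. lra.
    * reflexivity.
  + apply expandable_mult; [|now apply expandable_inv].
    apply expandable_plus; [now apply Hg|apply expandable_const].
Qed.

(** Iterated division by the variable: Taylor remainders factor through functions
    of the same class, to which the maximum principle applies again. *)
Lemma taylor_remainder (r : R) (c : nat -> C) (g : C -> C) (k : nat) :
  expandable_on r g -> taylor c g ->
  exists q, expandable_on r q /\ taylor (fun l => c (k + l)%nat) q /\
    forall z, g z = (jet c k z + z ^ k * q z)%C.
Proof.
intros Hg Hc. induction k as [|k (q & Hq & Hqc & E)].
- exists g. repeat split; auto. intros z. unfold jet. simpl. ring.
- exists (quot q (c (k + 1)%nat)). repeat split.
  + apply (expandable_quot r _ q Hq Hqc).
  + intros n. eapply has_jet_ext; [| |exact (has_jet_quot n _ _ (Hqc (S n)))].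
    * intros l _. apply (f_equal c). lia.
    * reflexivity.
  + intros z. rewrite E, (quot_eq q (c (k + 1)%nat) z), jet_S, (taylor_value _ _ Hqc).
    rewrite Nat.add_0_r. rewrite Cpow_S. ring.
Qed.

(** * The maximum principle *)

Lemma Cmod_le_sum (x y : R) : Cmod (x, y) <= Rabs x + Rabs y.
Proof.
replace ((x, y) : C) with (RtoC x + Ci * RtoC y)%C
  by (unfold RtoC, Ci, Cmult, Cplus; simpl; f_equal; ring).
eapply Rle_trans; [apply Cmod_triangle|].
rewrite Cmod_mult, Cmod_Ci, !Cmod_R. lra.
Qed.

(** Compactness of the closed disc: [delta] attached to a point is at once a
    radius and the inverse of a bound, so that the positive lower bound of [delta]
    given by the covering lemma is the inverse of a global bound. *)
Lemma disc_locally_bounded (r : R) (v : C -> R) :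
  (forall z, Cmod z <= r -> exists d B, 0 < d /\
     forall w, Cmod w < d -> Cmod (z + w) <= r -> v (z + w)%C <= B) ->
  exists B, forall z, Cmod z <= r -> v z <= B.
Proof.
intros H.
(* The factor 2 accounts for the covering lemma measuring distances by
   coordinates; points outside the disc get a neighbourhood that misses it. *)
assert (Hd : forall z : C, exists d : posreal,
  forall w, Cmod w < 2 * d -> Cmod (z + w) <= r -> v (z + w)%C <= / d).
{ intros z. destruct (Rle_lt_dec (Cmod z) r) as [Hz|Hz].
  - destruct (H z Hz) as (d & B & Hd & HB).
    assert (HB1 : 0 < Rabs B + 1) by (assert (A := Rabs_pos B); lra).
    assert (Hm : 0 < Rmin (d / 2) (/ (Rabs B + 1))).
    { apply Rmin_pos; [lra|now apply Rinv_0_lt_compat]. }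
    exists (mkposreal _ Hm). simpl. intros w Hw Hzw.
    assert (A1 := Rmin_l (d / 2) (/ (Rabs B + 1))).
    assert (A2 := Rmin_r (d / 2) (/ (Rabs B + 1))).
    apply Rle_trans with B; [apply HB; [lra|exact Hzw]|].
    apply Rle_trans with (Rabs B + 1); [assert (A := Rle_abs B); lra|].
    apply Rle_trans with (/ / (Rabs B + 1)); [rewrite Rinv_inv; lra|].
    apply Rinv_le_contravar; lra.
  - assert (Hm : 0 < (Cmod z - r) / 2) by lra.
    exists (mkposreal _ Hm). simpl. intros w Hw Hzw. exfalso.
    assert (A := Cmod_triangle_minus (z + w) w).
    replace (z + w - w)%C with z in A by ring. lra. }
pose (delta := fun x y => proj1_sig (constructive_indefinite_description _ (Hd (x, y)))).
destruct (compactness_value_2d (- r) r (- r) r delta) as [d Hcov].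
exists (/ d). intros [x y] Hz.
apply NNPP. intros Hn.
assert (Hxy := Rmax_Cmod (x, y)). simpl in Hxy.
assert (Hx := Rle_trans _ _ _ (Rmax_l _ _) Hxy).
assert (Hy := Rle_trans _ _ _ (Rmax_r _ _) Hxy).
apply (Hcov x y).
- apply Rabs_le_between. lra.
- apply Rabs_le_between. lra.
- intros (s & t & _ & _ & Hs & Ht & Hdd). apply Hn.
  unfold delta in Hs, Ht, Hdd.
  destruct (constructive_indefinite_description _ (Hd (s, t))) as [e He]. simpl in *.
  specialize (He (x - s, y - t)).
  replace ((s, t) + ((x - s)%R, (y - t)%R))%C with ((x, y) : C) in He
    by (unfold Cplus; simpl; f_equal; ring).
  apply Rle_trans with (/ e).
  + apply He; [|exact Hz]. eapply Rle_lt_trans; [apply Cmod_le_sum|]. lra.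
  + apply Rinv_le_contravar; [apply cond_pos|exact Hdd].
Qed.

(** If the supremum [S] were not attained, [1 / (S - u)] would be locally bounded,
    hence bounded, and [S] would not be the least upper bound. *)
Lemma disc_max (r : R) (u : C -> R) :
  0 <= r ->
  (forall z, Cmod z <= r -> forall eps, 0 < eps ->
     exists d, 0 < d /\ forall w, Cmod w < d -> Rabs (u (z + w)%C - u z) < eps) ->
  exists m, Cmod m <= r /\ forall z, Cmod z <= r -> u z <= u m.
Proof.
intros Hr Hu.
destruct (disc_locally_bounded r u) as [B HB].
{ intros z Hz. destruct (Hu z Hz 1 Rlt_0_1) as (d & Hd & H).
  exists d, (u z + 1). split; [exact Hd|]. intros w Hw _.
  specialize (H w Hw). apply Rabs_lt_between in H. lra. }
destruct (completeness (fun x => exists z, Cmod z <= r /\ x = u z)) as [S [HS1 HS2]].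
{ exists B. intros x (z & Hz & ->). now apply HB. }
{ exists (u (RtoC 0)), (RtoC 0). rewrite Cmod_0. now split. }
apply NNPP. intros Hn.
assert (Hlt : forall z, Cmod z <= r -> u z < S).
{ intros z Hz. apply Rnot_le_lt. intros Hle. apply Hn. exists z. split; [exact Hz|].
  intros y Hy. apply Rle_trans with S; [|exact Hle]. apply HS1. now exists y. }
destruct (disc_locally_bounded r (fun z => / (S - u z))) as [B' HB'].
{ intros z Hz. specialize (Hlt z Hz) as Hz'.
  destruct (Hu z Hz ((S - u z) / 2) ltac:(lra)) as (d & Hd & H).
  exists d, (/ ((S - u z) / 2)). split; [exact Hd|]. intros w Hw _.
  specialize (H w Hw). apply Rabs_lt_between in H.
  apply Rinv_le_contravar; lra. }
assert (HB0 : 0 < B').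
{ eapply Rlt_le_trans; [|apply (HB' (RtoC 0)); rewrite Cmod_0; exact Hr].
  apply Rinv_0_lt_compat. specialize (Hlt (RtoC 0)). rewrite Cmod_0 in Hlt. lra. }
assert (HiB := Rinv_0_lt_compat _ HB0).
assert (S <= S - / B'); [|lra].
apply HS2. intros x (z & Hz & ->).
specialize (HB' z Hz). specialize (Hlt z Hz). simpl in HB'.
apply Rinv_le_contravar in HB'; [|apply Rinv_0_lt_compat; lra].
rewrite Rinv_inv in HB'. lra.
Qed.

Lemma expandable_continuous (g : C -> C) (z : C) :
  expandable_at g z -> forall eps, 0 < eps ->
  exists d, 0 < d /\ forall w, Cmod w < d -> Cmod (g (z + w)%C - g z) < eps.
Proof.
intros [c Hc] eps Heps.
assert (H0 := taylor_value _ _ Hc). cbv beta in H0. rewrite Cplus_0_r in H0.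
destruct (Hc 1%nat) as (K & d & HK & Hd & H).
exists (Rmin d (eps / (K + 1))). split.
- apply Rmin_pos; [exact Hd|]. apply Rdiv_lt_0_compat; lra.
- intros w Hw. assert (A := Rmin_l d (eps / (K + 1))).
  assert (B := Rmin_r d (eps / (K + 1))).
  specialize (H w ltac:(lra)). rewrite jet_first in H.
  unfold jet in H. simpl in H. rewrite H0.
  replace (c O + w * 0)%C with (c O) in H by ring. rewrite Rmult_1_r in H.
  eapply Rle_lt_trans; [exact H|].
  apply Rle_lt_trans with ((K + 1) * Cmod w); [assert (C := Cmod_ge_0 w); nra|].
  replace eps with ((K + 1) * (eps / (K + 1))) at 1 by (field; lra).
  apply Rmult_lt_compat_l; lra.
Qed.

Lemma Cmod_continuous_sub (a b : C) : Rabs (Cmod a - Cmod b) <= Cmod (a - b).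
Proof.
apply Rabs_le. split.
- assert (H := Cmod_triangle_minus a (a - b)). replace (a - (a - b))%C with b in H by ring. lra.
- assert (H := Cmod_triangle (a - b) b). replace (a - b + b)%C with a in H by ring. lra.
Qed.

Lemma Cmod_pert_continuous (g : C -> C) (z : C) (e : R) :
  0 <= e -> expandable_at g z -> forall eps, 0 < eps ->
  exists d, 0 < d /\ forall w, Cmod w < d ->
    Rabs ((Cmod (g (z + w)%C) ^ 2 + e * Cmod (z + w) ^ 2)
          - (Cmod (g z) ^ 2 + e * Cmod z ^ 2)) < eps.
Proof.
intros He Hg eps Heps.
set (M := 2 * Cmod (g z) + 1 + e * (2 * Cmod z + 1)).
assert (Hgz := Cmod_ge_0 (g z)). assert (Hz := Cmod_ge_0 z).
assert (HM : 0 < M) by (unfold M; nra).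
set (s := Rmin 1 (eps / (2 * M))).
assert (Hs : 0 < s) by (apply Rmin_pos; [lra|apply Rdiv_lt_0_compat; lra]).
assert (Hs1 : s <= 1) by apply Rmin_l.
assert (HsM : M * s <= eps / 2).
{ replace (eps / 2) with (M * (eps / (2 * M))) by (field; lra).
  apply Rmult_le_compat_l; [lra|apply Rmin_r]. }
destruct (expandable_continuous g z Hg s Hs) as (d & Hd & H).
exists (Rmin d s). split; [now apply Rmin_pos|]. intros w Hw.
assert (A := Rmin_l d s). assert (B := Rmin_r d s).
specialize (H w ltac:(lra)).
assert (H1 := Cmod_continuous_sub (g (z + w)%C) (g z)).
assert (H2 := Cmod_continuous_sub (z + w) z).
replace (z + w - z)%C with w in H2 by ring.
set (a := Cmod (g (z + w)%C)) in *. set (b := Cmod (g z)) in *.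
set (x := Cmod (z + w)) in *. set (y := Cmod z) in *.
assert (Ha : 0 <= a) by apply Cmod_ge_0. assert (Hx : 0 <= x) by apply Cmod_ge_0.
assert (Q : forall p q, 0 <= p -> 0 <= q -> Rabs (p - q) <= s ->
  Rabs (p ^ 2 - q ^ 2) <= (2 * q + 1) * s).
{ intros p q Hp Hq Hpq. replace (p ^ 2 - q ^ 2) with ((p + q) * (p - q)) by ring.
  rewrite Rabs_mult. rewrite (Rabs_pos_eq (p + q)) by lra.
  apply Rmult_le_compat; try lra; [apply Rabs_pos|].
  apply Rabs_le_between in Hpq. lra. }
replace (a ^ 2 + e * x ^ 2 - (b ^ 2 + e * y ^ 2))
  with ((a ^ 2 - b ^ 2) + e * (x ^ 2 - y ^ 2)) by ring.
eapply Rle_lt_trans; [apply Rabs_triang|].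
rewrite Rabs_mult, (Rabs_pos_eq e) by exact He.
assert (Q1 := Q a b Ha Hgz ltac:(lra)). assert (Q2 := Q x y Hx Hz ltac:(lra)).
assert (e * Rabs (x ^ 2 - y ^ 2) <= e * ((2 * y + 1) * s)) by now apply Rmult_le_compat_l.
assert (E : M * s = (2 * b + 1) * s + e * ((2 * y + 1) * s)) by (unfold M; ring).
lra.
Qed.

Lemma Cmod_square (a : C) : Cmod a ^ 2 = fst a ^ 2 + snd a ^ 2.
Proof. rewrite Cmod2_alt. reflexivity. Qed.

Lemma inner_ge (a b : C) : - (Cmod a * Cmod b) <= fst a * fst b + snd a * snd b.
Proof.
assert (A := re_le_Cmod (Cconj a * b)).
rewrite Cmod_mult, Cmod_conj in A. apply Rabs_le_between in A.
unfold Re, Cconj, Cmult in A. simpl in A. lra.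
Qed.

(** The four points [z + i^k s] average the terms of degrees 1 to 3 to zero, so
    the mean of [g] over them is [g z + O(s^3)] and the mean of [|g|^2] is at least
    [|g z|^2 - O(s^3)], whereas the mean of [e |z|^2] gains [e s^2]. *)
Lemma no_interior_max (g : C -> C) (z : C) (e : R) :
  0 < e -> expandable_at g z ->
  ~ (exists d, 0 < d /\ forall w, Cmod w < d ->
       Cmod (g (z + w)%C) ^ 2 + e * Cmod (z + w) ^ 2 <= Cmod (g z) ^ 2 + e * Cmod z ^ 2).
Proof.
intros He [c Hc] (d & Hd & Hmax).
assert (H0 := taylor_value _ _ Hc). cbv beta in H0. rewrite Cplus_0_r in H0.
destruct (Hc 3%nat) as (K & d' & HK & Hd' & H).
set (p := Cmod (c O)).
assert (Hp : 0 <= p) by apply Cmod_ge_0.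
(* Small enough for the loss [2 p K s^3] to be less than the gain [e s^2]. *)
set (s := Rmin (Rmin d d' / 2) (e / (2 * p * K + 1))).
assert (HpK : 0 <= p * K) by now apply Rmult_le_pos.
assert (Hm : 0 < Rmin d d') by now apply Rmin_pos.
assert (Hs : 0 < s) by (apply Rmin_pos; [lra|apply Rdiv_lt_0_compat; lra]).
assert (Hsd : s < d /\ s < d').
{ assert (A := Rmin_l (Rmin d d' / 2) (e / (2 * p * K + 1))).
  assert (B := Rmin_l d d'). assert (C := Rmin_r d d'). fold s in A. lra. }
assert (Hse : (2 * p * K + 1) * s <= e).
{ replace e with ((2 * p * K + 1) * (e / (2 * p * K + 1))) by (field; lra).
  apply Rmult_le_compat_l; [lra|]. apply Rmin_r. }
pose (w := fun k => (Ci ^ k * RtoC s)%C).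
assert (Hw : forall k, Cmod (w k) = s).
{ intros k. unfold w. rewrite Cmod_mult, Cmod_pow, Cmod_Ci, pow1, Cmod_R, Rabs_pos_eq; lra. }
assert (Hg : forall k, Cmod (g (z + w k)%C - jet c 3 (w k)) <= K * s ^ 3).
{ intros k. specialize (H (w k)). rewrite (Hw k) in H. apply H. lra. }
assert (Hu : forall k, Cmod (g (z + w k)%C) ^ 2 + e * Cmod (z + w k) ^ 2 <= p ^ 2 + e * Cmod z ^ 2).
{ intros k. unfold p. rewrite <- H0. apply Hmax. rewrite Hw. lra. }
pose (D := fun k => (g (z + w k)%C - jet c 3 (w k))%C).
pose (E := csum D 4).
assert (HE : Cmod E <= 4 * (K * s ^ 3)).
{ eapply Rle_trans; [apply Cmod_csum|].
  eapply Rle_trans; [apply rsum_le with (G := fun _ => K * s ^ 3); intros; apply Hg|].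
  rewrite rsum_const. simpl. lra. }
assert (HG : csum (fun k => g (z + w k)%C) 4 = (4 * c O + E)%C).
{ unfold E, D, w, jet. simpl.
  replace (Ci * (Ci * (Ci * 1)))%C with (- Ci)%C
    by (unfold Ci, Cmult, Copp, RtoC; simpl; f_equal; ring).
  replace (Ci * (Ci * 1))%C with (- (1))%C
    by (unfold Ci, Cmult, Copp, RtoC; simpl; f_equal; ring).
  replace (RtoC 4) with (1 + 1 + 1 + 1)%C by (rewrite <- !RtoC_plus; f_equal; ring).
  assert (I2 : (Ci * Ci = - (1))%C)
    by (unfold Ci, Cmult, Copp, RtoC; simpl; f_equal; ring).
  ring [I2]. }

assert (Hz4 : rsum (fun k => Cmod (z + w k) ^ 2) 4 = 4 * Cmod z ^ 2 + 4 * s ^ 2).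
{ unfold w. rewrite Cmod_square.
  rewrite (rsum_ext _ _ 4 (fun k _ => Cmod_square (z + Ci ^ k * RtoC s))).
  unfold Ci, RtoC. simpl. ring. }
(* From [|g - c 0|^2 >= 0]. *)
assert (Hlow : forall k, 2 * (fst (c O) * fst (g (z + w k)%C) + snd (c O) * snd (g (z + w k)%C))
  - p ^ 2 <= Cmod (g (z + w k)%C) ^ 2).
{ intros k. unfold p. rewrite !Cmod_square.
  assert (A := pow2_ge_0 (fst (g (z + w k)%C) - fst (c O))).
  assert (B := pow2_ge_0 (snd (g (z + w k)%C) - snd (c O))). nra. }
assert (HcE : - (p * Cmod E) <= fst (c O) * fst E + snd (c O) * snd E).
{ apply inner_ge. }
assert (Hf := f_equal fst HG). assert (Hs' := f_equal snd HG).
clearbody E. cbn [csum] in Hf, Hs'. simpl in Hf, Hs'.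
assert (Hp2 : p ^ 2 = fst (c O) ^ 2 + snd (c O) ^ 2) by apply Cmod_square.
cbn [rsum] in Hz4.
assert (L0 := Hlow 0%nat). assert (L1 := Hlow 1%nat).
assert (L2 := Hlow 2%nat). assert (L3 := Hlow 3%nat).
assert (U0 := Hu 0%nat). assert (U1 := Hu 1%nat).
assert (U2 := Hu 2%nat). assert (U3 := Hu 3%nat).
assert (HpE : p * Cmod E <= p * (4 * (K * s ^ 3))) by (apply Rmult_le_compat_l; lra).
clear - L0 L1 L2 L3 U0 U1 U2 U3 HpE Hz4 Hf Hs' HcE Hp2 Hs Hse He HpK.
set (g0 := g (z + w 0%nat)%C) in *. set (g1 := g (z + w 1%nat)%C) in *.
set (g2 := g (z + w 2%nat)%C) in *. set (g3 := g (z + w 3%nat)%C) in *.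
assert (X : 4 * e * s ^ 2 <= 8 * (p * K) * s ^ 3).
{ assert (F : fst (c O) * (fst g0 + fst g1 + fst g2 + fst g3)
    = fst (c O) * (4 * fst (c O) + fst E)) by (f_equal; lra).
  assert (G : snd (c O) * (snd g0 + snd g1 + snd g2 + snd g3)
    = snd (c O) * (4 * snd (c O) + snd E)) by (f_equal; lra).
  nra. }
assert (Y : 2 * (p * K) * s < e) by nra.
assert (Z : 0 < s ^ 2) by (apply pow_lt; exact Hs).
nra.
Qed.

(** The perturbation [e |z|^2] removes any need to discuss functions that are
    locally constant; it is sent to 0 at the end. *)
Lemma maximum_principle (g : C -> C) (r M : R) :
  0 <= r -> expandable_on r g ->
  (forall z, Cmod z = r -> Cmod (g z) <= M) ->
  forall z, Cmod z <= r -> Cmod (g z) <= M.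
Proof.
intros Hr Hg HM z Hz.
assert (HM0 : 0 <= M).
{ eapply Rle_trans; [apply Cmod_ge_0|apply (HM (RtoC r))].
  rewrite Cmod_R. now apply Rabs_pos_eq. }
apply Rsqr_incr_0; [|apply Cmod_ge_0|exact HM0]. rewrite !Rsqr_pow2.
apply Rle_plus_epsilon. intros eps Heps.
assert (Hr2 : 0 <= r ^ 2) by apply pow2_ge_0.
set (e := eps / (r ^ 2 + 1)).
assert (He : 0 < e) by (apply Rdiv_lt_0_compat; lra).
assert (Her : e * r ^ 2 <= eps).
{ replace eps with (e * (r ^ 2 + 1)) by (unfold e; field; lra). nra. }
destruct (disc_max r (fun z => Cmod (g z) ^ 2 + e * Cmod z ^ 2)) as (m & Hm & Hmax);
  [exact Hr| |].
{ intros y Hy. apply Cmod_pert_continuous; [lra|]. now apply Hg. }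
assert (A := Hmax z Hz). cbv beta in A.
assert (Hz2 : 0 <= e * Cmod z ^ 2) by (apply Rmult_le_pos; [lra|apply pow2_ge_0]).
destruct (Rle_lt_or_eq_dec _ _ Hm) as [Hlt|Heq].
- exfalso. apply (no_interior_max g m e He (Hg m Hm)).
  exists (r - Cmod m). split; [lra|]. intros w Hw. apply Hmax.
  eapply Rle_trans; [apply Cmod_triangle|]. lra.
- rewrite Heq in A.
  assert (Cmod (g m) ^ 2 <= M ^ 2).
  { apply pow_incr. split; [apply Cmod_ge_0|now apply HM]. }
  lra.
Qed.

(** * Roots of unity and Cauchy's estimate *)

Lemma primitive_root_of_unity (N : nat) : (0 < N)%nat ->
  exists zeta : C, Cmod zeta = 1 /\ (zeta ^ N)%C = RtoC 1 /\
    forall l, (0 < l < N)%nat -> (zeta ^ l)%C <> RtoC 1.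
Proof.
intros HN. assert (HN' : 0 < INR N) by now apply lt_0_INR.
set (t := 2 * PI / INR N).
assert (Hpow : forall l, (((cos t, sin t) : C) ^ l)%C = ((cos (INR l * t), sin (INR l * t)) : C)).
{ induction l as [|l IH].
  - simpl. rewrite Rmult_0_l, cos_0, sin_0. reflexivity.
  - rewrite Cpow_S, IH, S_INR. replace ((INR l + 1) * t) with (t + INR l * t) by ring.
    rewrite cos_plus, sin_plus. unfold Cmult. simpl. f_equal; ring. }
exists (cos t, sin t). repeat split.
- unfold Cmod. simpl. replace (_ + _) with (Rsqr (sin t) + Rsqr (cos t)) by (unfold Rsqr; ring).
  rewrite sin2_cos2. apply sqrt_1.
- rewrite Hpow. replace (INR N * t) with (2 * PI) by (unfold t; field; lra).
  now rewrite cos_2PI, sin_2PI.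
- intros l [Hl0 HlN] E. rewrite Hpow in E. apply (f_equal fst) in E. simpl in E.
  apply lt_0_INR in Hl0. apply lt_INR in HlN.
  assert (Hpi := PI_RGT_0).
  assert (Hx : 0 < INR l * t / 2 < PI).
  { unfold t. replace (INR l * (2 * PI / INR N) / 2) with (PI * (INR l / INR N)) by (field; lra).
    assert (0 < INR l / INR N < 1); [|nra].
    split; [now apply Rdiv_lt_0_compat|]. apply Rlt_div_l; lra. }
  replace (INR l * t) with (2 * (INR l * t / 2)) in E by field.
  rewrite cos_2a_sin in E.
  assert (H := sin_gt_0 _ (proj1 Hx) (proj2 Hx)). nra.
Qed.

Lemma geometric_csum (y : C) (n : nat) :
  ((1 - y) * csum (fun j => y ^ j) n = 1 - y ^ n)%C.
Proof.
induction n as [|n IH]; [simpl; ring|].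
cbn [csum]. rewrite Cmult_plus_distr_l, IH, Cpow_S. ring.
Qed.

Lemma Cmod_1_conj (x : C) : Cmod x = 1 -> (x * Cconj x)%C = RtoC 1.
Proof. intros H. rewrite <- Cmod2_conj, H. simpl. now rewrite !Rmult_1_r. Qed.

(** Orthogonality of the characters [x^l] and [x^m] on the [N]-th roots of unity,
    for exponents less than [N] apart. *)
Lemma orthogonal_roots (N : nat) : (0 < N)%nat ->
  exists zeta : C, Cmod zeta = 1 /\ forall l m, (l < N + m)%nat -> (m < N + l)%nat ->
    csum (fun j => ((zeta ^ j) ^ l * Cconj (zeta ^ j) ^ m)%C) N
    = if Nat.eq_dec l m then RtoC (INR N) else RtoC 0.
Proof.
intros HN. destruct (primitive_root_of_unity N HN) as (zeta & Hm & HzN & Hz).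
exists zeta. split; [exact Hm|]. intros l m Hlm Hml.
assert (Hinv := Cmod_1_conj zeta Hm).
assert (Hpinv : forall p, (zeta ^ p * Cconj zeta ^ p)%C = RtoC 1).
{ intros p. now rewrite <- Cpow_mult_l, Hinv, Cpow_1_l. }
set (y := (zeta ^ l * Cconj zeta ^ m)%C).
rewrite (csum_ext _ (fun j => (y ^ j)%C)).
2:{ intros j _. unfold y. rewrite Cpow_conj, Cpow_mult_l, <- !Cpow_mult_r.
    now rewrite (Nat.mul_comm l), (Nat.mul_comm m). }
destruct (Nat.eq_dec l m) as [->|Hne].
- unfold y. rewrite (Hpinv m).
  rewrite (csum_ext _ (fun _ => RtoC 1)) by (intros; apply Cpow_1_l).
  rewrite csum_const. ring.
- assert (Hy : y <> RtoC 1).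
  { intros E. destruct (Nat.lt_ge_cases l m) as [Hlt|Hge].
    - apply (Hz (m - l)%nat); [lia|].
      assert (F := Hpinv m). replace m with (l + (m - l))%nat in F at 1 by lia.
      rewrite Cpow_add_r in F.
      replace (zeta ^ l * zeta ^ (m - l) * Cconj zeta ^ m)%C
        with (y * zeta ^ (m - l))%C in F by (unfold y; ring).
      rewrite E in F. now rewrite Cmult_1_l in F.
    - apply (Hz (l - m)%nat); [lia|]. rewrite <- E. unfold y.
      replace l with (l - m + m)%nat at 2 by lia.
      rewrite Cpow_add_r, <- Cmult_assoc, Hpinv. ring. }
  assert (HyN : (y ^ N)%C = RtoC 1).
  { unfold y. rewrite Cpow_mult_l, <- !Cpow_mult_r, (Nat.mul_comm l), (Nat.mul_comm m).
    rewrite !Cpow_mult_r, <- Cpow_conj, HzN.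
    replace (Cconj 1) with (RtoC 1) by (unfold Cconj, RtoC; simpl; f_equal; ring).
    now rewrite !Cpow_1_l, Cmult_1_l. }
  assert (G := geometric_csum y N). rewrite HyN in G.
  replace (1 - 1)%C with (RtoC 0) in G by ring.
  assert (Hy1 : (1 - y)%C <> RtoC 0) by (intros A; apply Hy; symmetry; now apply Ceq_minus).
  replace (csum (fun j => y ^ j)%C N)
    with (/ (1 - y) * ((1 - y) * csum (fun j => y ^ j) N))%C by (field; exact Hy1).
  rewrite G. ring.
Qed.

(** The average of [conj(zeta^j)^n g(zeta^j z)] over the [n+1]-st roots of unity
    [zeta^j] keeps the coefficient of [z^n] and kills those below it; divided by
    [z^n], it is bounded at the origin by the maximum principle. *)
Lemma cauchy_estimate (r M : R) (c : nat -> C) (g : C -> C) (n : nat) :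
  0 < r -> expandable_on r g -> taylor c g ->
  (forall z, Cmod z = r -> Cmod (g z) <= M) -> Cmod (c n) * r ^ n <= M.
Proof.
intros Hr Hg Hc HM.
destruct (orthogonal_roots (S n) ltac:(lia)) as (zeta & Hz & Hsum).
assert (Hzp : forall j, Cmod (zeta ^ j) = 1) by (intros; rewrite Cmod_pow, Hz; apply pow1).
set (A := fun z => csum (fun j => (Cconj (zeta ^ j) ^ n * g (zeta ^ j * z))%C) (S n)).
set (a := fun l => csum (fun j => (Cconj (zeta ^ j) ^ n * (c l * (zeta ^ j) ^ l))%C) (S n)).
assert (Ha : forall l, a l = (c l * csum (fun j => ((zeta ^ j) ^ l * Cconj (zeta ^ j) ^ n)%C) (S n))%C).
{ intros l. unfold a. rewrite <- csum_scal. apply csum_ext. intros; ring. }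
assert (HA : taylor a A).
{ intros m. unfold A, a.
  apply (has_jet_csum m (S n) (fun j l => (Cconj (zeta ^ j) ^ n * (c l * (zeta ^ j) ^ l))%C)
    (fun j z => (Cconj (zeta ^ j) ^ n * g (zeta ^ j * z))%C)).
  intros j _. apply (has_jet_scal m _ (fun l => (c l * (zeta ^ j) ^ l)%C)
    (fun z => g (zeta ^ j * z)%C)). now apply has_jet_rotate. }
assert (HAe : expandable_on r A).
{ intros z Hzr.
  apply (expandable_csum (fun j z => (Cconj (zeta ^ j) ^ n * g (zeta ^ j * z))%C)).
  intros j _. apply expandable_mult; [apply expandable_const|].
  apply expandable_rotate; [apply Hzp|]. apply Hg. rewrite Cmod_mult, Hzp. lra. }
destruct (taylor_remainder r a A n HAe HA) as (q & Hq & Hqc & E).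
assert (HN : 0 < INR (S n)) by (apply lt_0_INR; lia).
assert (Hrn : 0 < r ^ n) by now apply pow_lt.
assert (Hq0 : q (RtoC 0) = (RtoC (INR (S n)) * c n)%C).
{ rewrite (taylor_value _ _ Hqc), Nat.add_0_r, Ha, Hsum by lia.
  destruct (Nat.eq_dec n n) as [_|F]; [ring|now elim F]. }
assert (Hbound : Cmod (q (RtoC 0)) <= INR (S n) * M / r ^ n).
{ apply (maximum_principle q r); [lra|exact Hq| |rewrite Cmod_0; lra].
  intros z Hzr. apply Rle_div_r; [exact Hrn|].
  replace (Cmod (q z) * r ^ n) with (Cmod (A z)).
  - eapply Rle_trans; [apply Cmod_csum|].
    rewrite <- rsum_const. apply rsum_le. intros j _.
    rewrite Cmod_mult, Cmod_pow, Cmod_conj, Hzp, pow1, Rmult_1_l.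
    apply HM. rewrite Cmod_mult, Hzp, Hzr. ring.
  - rewrite E. replace (jet a n z) with (RtoC 0).
    + rewrite Cplus_0_l, Cmod_mult, Cmod_pow, Hzr. ring.
    + symmetry. apply csum_zero. intros l Hl. rewrite Ha, Hsum by lia.
      destruct (Nat.eq_dec l n); [lia|ring]. }
rewrite Hq0, Cmod_mult, Cmod_R, Rabs_pos_eq in Hbound by lra.
apply Rle_div_r in Hbound; [|exact Hrn].
apply Rmult_le_reg_l with (INR (S n)); [exact HN|]. lra.
Qed.

(** * Taylor remainders on the whole disc *)

Definition expandable_in_disc (g : C -> C) : Prop :=
  forall z, unit_disc z -> expandable_at g z.

Lemma expandable_disc_on (g : C -> C) (r : R) :
  r < 1 -> expandable_in_disc g -> expandable_on r g.
Proof. intros Hr Hg z Hz. apply Hg. unfold unit_disc. lra. Qed.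

Lemma expandable_bounded (r : R) (g : C -> C) :
  expandable_on r g -> exists B, forall z, Cmod z <= r -> Cmod (g z) <= B.
Proof.
intros Hg. apply disc_locally_bounded. intros z Hz.
destruct (expandable_continuous g z (Hg z Hz) 1 Rlt_0_1) as (d & Hd & H).
exists d, (Cmod (g z) + 1). split; [exact Hd|]. intros w Hw _.
specialize (H w Hw). assert (A := Cmod_continuous_sub (g (z + w)%C) (g z)).
apply Rabs_le_between in A. lra.
Qed.

(** On [|z| = r] the remainder [g - jet c k] is bounded uniformly in [k], by
    Cauchy's estimate on a larger circle; the maximum principle for the remainder
    divided by [z^k] spreads this to the inside with the factor [(|z| / r)^k]. *)
Lemma remainder_bound (c : nat -> C) (g : C -> C) (r : R) :
  0 < r < 1 -> expandable_in_disc g -> taylor c g ->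
  exists M, 0 <= M /\
    forall k z, Cmod z <= r -> Cmod (g z - jet c k z) <= M * (Cmod z / r) ^ k.
Proof.
intros Hr Hg Hc. set (r' := (1 + r) / 2).
assert (Hr' : r < r' < 1) by (unfold r'; lra).
destruct (expandable_bounded r' g) as [B HB]; [apply expandable_disc_on; tauto|].
assert (HB0 : 0 <= B).
{ eapply Rle_trans; [apply Cmod_ge_0|apply (HB (RtoC 0))]. rewrite Cmod_0. lra. }
assert (Hcl : forall l, Cmod (c l) <= B / r' ^ l).
{ intros l. assert (Hp : 0 < r' ^ l) by (apply pow_lt; lra).
  apply Rle_div_r; [exact Hp|].
  apply (cauchy_estimate r' B c g l); [lra| |exact Hc|intros; apply HB; lra].
  apply expandable_disc_on; tauto. }
assert (Hq1 : 0 <= r / r' < 1).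
{ split; [apply Rdiv_le_0_compat; lra|]. apply Rlt_div_l; lra. }
assert (Hi : 0 < / (1 - r / r')) by (apply Rinv_0_lt_compat; lra).
exists (B + B * / (1 - r / r')). split; [nra|]. intros k z Hz.
destruct (taylor_remainder r c g k (expandable_disc_on g r (proj2 Hr) Hg) Hc)
  as (q & Hq & _ & E).
assert (Hrk : 0 < r ^ k) by (apply pow_lt; lra).
assert (Hqb : Cmod (q z) <= (B + B * / (1 - r / r')) / r ^ k).
{ apply (maximum_principle q r); [lra|exact Hq| |exact Hz].
  intros y Hy. apply Rle_div_r; [exact Hrk|].
  replace (Cmod (q y) * r ^ k) with (Cmod (g y - jet c k y)).
  - eapply Rle_trans; [apply Cmod_triangle_minus|].
    apply Rplus_le_compat; [apply HB; lra|].
    eapply Rle_trans; [apply Cmod_jet_le|].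
    apply Rle_trans with (rsum (fun l => B * (r / r') ^ l) k).
    + apply rsum_le. intros l _. rewrite Hy.
      unfold Rdiv at 1. rewrite Rpow_mult_distr, pow_inv.
      replace (B * (r ^ l * / r' ^ l)) with (B / r' ^ l * r ^ l) by (unfold Rdiv; ring).
      apply Rmult_le_compat_r; [apply pow_le; lra|apply Hcl].
    + rewrite rsum_scal. apply Rmult_le_compat_l; [exact HB0|].
      now apply geometric_rsum_le.
  - rewrite E. replace (jet c k y + y ^ k * q y - jet c k y)%C with (y ^ k * q y)%C by ring.
    rewrite Cmod_mult, Cmod_pow, Hy. ring. }
rewrite E. replace (jet c k z + z ^ k * q z - jet c k z)%C with (z ^ k * q z)%C by ring.
rewrite Cmod_mult, Cmod_pow. unfold Rdiv in *. rewrite Rpow_mult_distr, pow_inv.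
assert (Hzk : 0 <= Cmod z ^ k) by (apply pow_le, Cmod_ge_0).
apply Rle_trans with (Cmod z ^ k * ((B + B * / (1 - r * / r')) * / r ^ k)).
- now apply Rmult_le_compat_l.
- right; ring.
Qed.

Lemma pseries_partial_sum (c : nat -> C) (z : C) (n : nat) :
  sum_n (fun l => scal (pow_n (K := C_AbsRing) z l) (c l)) n = jet c (S n) z.
Proof.
assert (Hp : forall l, pow_n (K := C_AbsRing) z l = (z ^ l)%C).
{ induction l as [|l IH]; [reflexivity|]. simpl. now rewrite IH. }
assert (Hs : forall l, scal (pow_n (K := C_AbsRing) z l) (c l) = (c l * z ^ l)%C).
{ intros l. rewrite Hp. apply Cmult_comm. }
induction n as [|n IH].
- rewrite sum_O, Hs. unfold jet. simpl. ring.
- rewrite sum_Sn, IH, Hs, (jet_S c (S n)). reflexivity.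
Qed.

Lemma locally_Cmod (l : C) (P : C -> Prop) :
  locally l P <-> exists eps, 0 < eps /\ forall y, Cmod (y - l) < eps -> P y.
Proof.
split.
- intros [e He]. exists e. split; [apply cond_pos|]. intros y Hy. apply He.
  now apply C_NormedModule_mixin_compat1.
- intros (e & He & H).
  assert (H2 : 0 < sqrt 2) by (apply sqrt_lt_R0; lra).
  exists (mkposreal _ (Rdiv_lt_0_compat _ _ He H2)). intros y Hy. apply H.
  apply C_NormedModule_mixin_compat2 in Hy. simpl in Hy.
  replace (sqrt 2 * (e / sqrt 2)) with e in Hy by (field; lra). exact Hy.
Qed.

Lemma is_pseries_jet (c : nat -> C) (z l : C) :
  is_pseries c z l <->
  forall eps, 0 < eps -> exists N, forall n, (N <= n)%nat -> Cmod (jet c n z - l) < eps.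
Proof.
split.
- intros H eps Heps.
  assert (Hl : locally l (fun y => Cmod (y - l) < eps)).
  { apply locally_Cmod. exists eps. auto. }
  destruct (H _ Hl) as [N HN]. exists (S N). intros [|n] Hn; [lia|].
  specialize (HN n ltac:(lia)). cbv beta in HN. now rewrite pseries_partial_sum in HN.
- intros H P HP. apply locally_Cmod in HP. destruct HP as (eps & Heps & HP).
  destruct (H eps Heps) as [N HN]. exists N. intros n Hn. apply HP.
  rewrite pseries_partial_sum. apply HN. lia.
Qed.

Lemma geometric_small (M q eps : R) :
  0 <= M -> 0 <= q < 1 -> 0 < eps ->
  exists N, forall n, (N <= n)%nat -> M * q ^ n < eps.
Proof.
intros HM Hq Heps.
destruct (pow_lt_1_zero q) with (y := eps / (M + 1)) as [N HN].
- rewrite Rabs_pos_eq; lra.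
- apply Rdiv_lt_0_compat; lra.
- exists N. intros n Hn. specialize (HN n Hn).
  assert (Hp : 0 <= q ^ n) by (apply pow_le; lra).
  rewrite Rabs_pos_eq in HN by exact Hp.
  apply Rlt_div_r in HN; [|lra]. nra.
Qed.

(** Convergence at the point [s] makes [|c l| s^l] bounded, hence the tails
    geometric on [|w| < s / 2]. *)
Lemma pseries_taylor (c : nat -> C) (g : C -> C) (r : R) :
  0 < r -> (forall w, Cmod w < r -> is_pseries c w (g w)) -> taylor c g.
Proof.
intros Hr H n. set (s := r / 2).
assert (Hs : 0 < s < r) by (unfold s; lra).
assert (Hcs : exists B, 0 <= B /\ forall l, Cmod (c l) * s ^ l <= B).
{ assert (Hp := H (RtoC s)). rewrite Cmod_R, Rabs_pos_eq in Hp by lra.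
  specialize (Hp ltac:(lra)). rewrite is_pseries_jet in Hp.
  destruct (Hp 1 Rlt_0_1) as [N HN].
  assert (Hfin : exists B, 0 <= B /\ forall l, (l < N)%nat -> Cmod (c l) * s ^ l <= B).
  { clear. induction N as [|N (B & HB0 & HB)]; [exists 0; split; [lra|lia]|].
    exists (Rmax B (Cmod (c N) * s ^ N)). split.
    - eapply Rle_trans; [exact HB0|apply Rmax_l].
    - intros l Hl. destruct (Nat.eq_dec l N) as [->|Hne]; [apply Rmax_r|].
      eapply Rle_trans; [apply HB; lia|apply Rmax_l]. }
  destruct Hfin as (B & HB0 & HB). exists (B + 2). split; [lra|]. intros l.
  destruct (Nat.lt_ge_cases l N) as [Hl|Hl]; [specialize (HB l Hl); lra|].
  assert (A1 := HN l Hl). assert (A2 := HN (S l) ltac:(lia)). rewrite jet_S in A2.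
  set (L := g (RtoC s)) in *. set (j := jet c l (RtoC s)) in *.
  set (t := (c l * RtoC s ^ l)%C) in *.
  assert (A3 : Cmod t <= Cmod (j + t - L) + Cmod (j - L)).
  { replace t with ((j + t - L) - (j - L))%C at 1 by ring. apply Cmod_triangle_minus. }
  unfold t in A3 at 1. rewrite Cmod_mult, Cmod_pow, Cmod_R, Rabs_pos_eq in A3; lra. }
destruct Hcs as (B & HB0 & HB).
assert (Hsn : 0 < s ^ n) by (apply pow_lt; lra).
exists (2 * B / s ^ n), (s / 2).
repeat split; [apply Rdiv_le_0_compat; lra|lra|]. intros w Hw.
assert (Hw0 := Cmod_ge_0 w).
assert (Hq : 0 <= Cmod w / s < 1 / 2).
{ split; [apply Rdiv_le_0_compat; lra|]. apply Rlt_div_l; lra. }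
set (q := Cmod w / s) in *.
replace (2 * B / s ^ n * Cmod w ^ n) with (2 * B * q ^ n).
2:{ unfold q, Rdiv. rewrite Rpow_mult_distr, pow_inv. ring. }
assert (Hqn : 0 <= q ^ n) by (apply pow_le; lra).
assert (Htail : forall m, Cmod (jet c (n + m) w - jet c n w) <= 2 * B * q ^ n).
{ intros m.
  assert (X : Cmod (jet c (n + m) w - jet c n w) <= B * q ^ n * rsum (fun l => q ^ l) m).
  { induction m as [|m IH].
    - rewrite Nat.add_0_r. unfold Cminus. rewrite Cplus_opp_r, Cmod_0. simpl. lra.
    - rewrite Nat.add_succ_r, jet_S.
      replace (jet c (n + m) w + c (n + m)%nat * w ^ (n + m) - jet c n w)%C
        with ((jet c (n + m) w - jet c n w) + c (n + m)%nat * w ^ (n + m))%C by ring.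
      eapply Rle_trans; [apply Cmod_triangle|].
      cbn [rsum]. rewrite Rmult_plus_distr_l. apply Rplus_le_compat; [exact IH|].
      rewrite Cmod_mult, Cmod_pow, Rmult_assoc, <- pow_add.
      replace (Cmod w) with (q * s) by (unfold q; field; lra).
      rewrite Rpow_mult_distr. assert (Q := HB (n + m)%nat).
      assert (P : 0 <= q ^ (n + m)) by (apply pow_le; lra). nra. }
  eapply Rle_trans; [exact X|].
  assert (Y := geometric_rsum_le q m ltac:(lra)).
  assert (Z : / (1 - q) <= 2).
  { replace 2 with (/ (1 / 2)) by field. apply Rinv_le_contravar; lra. }
  assert (0 <= B * q ^ n) by now apply Rmult_le_pos. nra. }
apply Rle_plus_epsilon. intros eps Heps.
assert (Hwr : Cmod w < r) by lra.
destruct (proj1 (is_pseries_jet c w (g w)) (H w Hwr) eps Heps) as [N HN].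
specialize (HN (n + N)%nat ltac:(lia)). specialize (Htail N).
replace (g w - jet c n w)%C with ((jet c (n + N) w - jet c n w) - (jet c (n + N) w - g w))%C by ring.
eapply Rle_trans; [apply Cmod_triangle_minus|]. lra.
Qed.

Lemma analytic_expandable (g : C -> C) :
  analytic_on unit_disc g -> expandable_in_disc g.
Proof.
intros H z Hz. destruct (H z Hz) as (c & eps & Heps & Hc).
exists c. now apply pseries_taylor with eps.
Qed.

(** * Termwise differentiation *)

Lemma taylor_derive (c : nat -> C) (g : C -> C) (z : C) :
  taylor c (fun w => g (z + w)%C) -> C_derive g z = c 1%nat.
Proof.
intros Hc.
assert (H0 := taylor_value _ _ Hc). cbv beta in H0. rewrite Cplus_0_r in H0.
destruct (Hc 2%nat) as (K & d & HK & Hd & H).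
apply is_C_lim_unique. intros P HP. apply locally_Cmod in HP.
destruct HP as (eps & Heps & HP).
apply locally_Cmod. exists (Rmin d (eps / (K + 1))). split.
{ apply Rmin_pos; [exact Hd|]. apply Rdiv_lt_0_compat; lra. }
intros y Hy Hyz. apply HP.
assert (A := Rmin_l d (eps / (K + 1))). assert (B := Rmin_r d (eps / (K + 1))).
set (w := (y - z)%C) in *.
assert (Hw0 : w <> RtoC 0) by (intros E; apply Hyz; now apply Ceq_minus).
specialize (H w ltac:(lra)). replace (z + w)%C with y in H by (unfold w; ring).
unfold jet in H. simpl in H. rewrite <- H0 in H.
assert (Hw : 0 < Cmod w) by now apply Cmod_gt_0.
replace ((g y - g z) / w - c 1%nat)%C
  with ((g y - (0 + g z * 1 + c 1%nat * (w * 1))) / w)%C by (field; exact Hw0).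
rewrite Cmod_div by exact Hw0.
apply Rle_lt_trans with (K * Cmod w).
- apply Rle_div_l; [exact Hw|]. lra.
- apply Rle_lt_trans with ((K + 1) * Cmod w); [nra|].
  replace eps with ((K + 1) * (eps / (K + 1))) by (field; lra).
  apply Rmult_lt_compat_l; lra.
Qed.

Lemma taylor_pow_derive (z : C) (k : nat) :
  exists p, taylor p (fun w => ((z + w) ^ S k)%C) /\
    p 1%nat = (RtoC (INR (S k)) * z ^ k)%C.
Proof.
induction k as [|k (p & Hp & Hp1)].
- eexists. split.
  + intros n. eapply has_jet_ext; [reflexivity| |apply (taylor_id z n)].
    intros w. cbv beta. now rewrite Cpow_1_r.
  + simpl. ring.
- eexists. split.
  + exact (taylor_mult _ _ _ _ (taylor_id z) Hp).
  + assert (H0 := taylor_value _ _ Hp). cbv beta in H0. rewrite Cplus_0_r in H0.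
    cbn [conv]. rewrite Hp1, <- H0, (S_INR (S k)), RtoC_plus, !Cpow_S. ring.
Qed.

Lemma taylor_jet_derive (c : nat -> C) (z : C) (k : nat) :
  exists p, taylor p (fun w => jet c (S k) (z + w)%C) /\
    p 1%nat = jet (fun l => (RtoC (INR (S l)) * c (S l))%C) k z.
Proof.
induction k as [|k (p & Hp & Hp1)].
- eexists. split.
  + intros n. eapply has_jet_ext; [reflexivity| |apply (taylor_const (c O) n)].
    intros w. cbv beta. rewrite jet_first. unfold jet. simpl. ring.
  + reflexivity.
- destruct (taylor_pow_derive z k) as (q & Hq & Hq1). eexists. split.
  + intros n. eapply has_jet_ext; [reflexivity| |
      exact (has_jet_plus n _ _ _ _ (Hp n) (has_jet_scal n (c (S k)) _ _ (Hq n)))].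
    reflexivity.
  + cbv beta. rewrite jet_S, Hp1, Hq1. ring.
Qed.

(** Near [z] the remainder [g - jet c (k+1)] is [O(q^k)] for some [q < 1], by
    [remainder_bound]; its first Taylor coefficient at [z], which is the difference
    of the derivatives, inherits this bound from Cauchy's estimate. *)
Lemma derive_disc_expansion (c : nat -> C) (g : C -> C) :
  expandable_in_disc g -> taylor c g ->
  disc_expansion (fun l => (RtoC (INR (S l)) * c (S l))%C) (C_derive g).
Proof.
intros Hg Hc z Hz. destruct (Hg z Hz) as [cz Hcz].
rewrite (taylor_derive _ _ _ Hcz).
unfold unit_disc in Hz. assert (H0 := Cmod_ge_0 z).
set (r := (1 + Cmod z) / 2). set (s := (Cmod z + r) / 2).
assert (Hr : Cmod z < s < r /\ r < 1) by (unfold s, r; lra).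
destruct (remainder_bound c g r ltac:(lra) Hg Hc) as (M & HM & H).
apply is_pseries_jet. intros eps Heps.
set (t := s - Cmod z). assert (Ht : 0 < t) by (unfold t; lra).
assert (Hq : 0 <= s / r < 1).
{ split; [apply Rdiv_le_0_compat; lra|]. apply Rlt_div_l; lra. }
destruct (geometric_small M (s / r) (eps * t) HM Hq ltac:(nra)) as [N HN].
exists N. intros k Hk.
destruct (taylor_jet_derive c z k) as (p & Hp & <-).
assert (HE := cauchy_estimate t (M * (s / r) ^ S k) (fun l => (cz l + RtoC (-1) * p l)%C)
  (fun w => (g (z + w)%C + RtoC (-1) * jet c (S k) (z + w))%C) 1%nat Ht).
rewrite Cmod_minus_sym.
replace (cz 1%nat - p 1%nat)%C with (cz 1%nat + RtoC (-1) * p 1%nat)%C by ring.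
apply Rmult_lt_reg_r with t; [exact Ht|].
eapply Rle_lt_trans; [|apply (HN (S k)); lia].
rewrite <- (pow_1 t) at 1. apply HE.
- intros w Hw. apply expandable_plus; [|apply expandable_mult; [apply expandable_const|]].
  + apply expandable_shift, Hg. unfold unit_disc.
    eapply Rle_lt_trans; [apply Cmod_triangle|]. unfold t in Hw. lra.
  + apply (expandable_shift (jet c (S k))), expandable_jet.
- intros n. apply (has_jet_plus n); [apply Hcz|]. apply (has_jet_scal n). apply Hp.
- intros w Hw.
  assert (Hzw : Cmod (z + w) <= s).
  { eapply Rle_trans; [apply Cmod_triangle|]. unfold t in Hw. lra. }
  replace (g (z + w)%C + RtoC (-1) * jet c (S k) (z + w))%C
    with (g (z + w)%C - jet c (S k) (z + w))%C by ring.
  eapply Rle_trans; [apply H; lra|]. apply Rmult_le_compat_l; [exact HM|].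
  apply pow_incr. split; [apply Rdiv_le_0_compat; [apply Cmod_ge_0|lra]|].
  apply Rmult_le_compat_r; [|exact Hzw]. left. apply Rinv_0_lt_compat. lra.
Qed.

(** * Coefficients of bounded functions *)

Lemma Cmod_align (a b : C) (B : R) :
  (forall v, Cmod v = 1 -> Cmod (a + v * b) <= B) -> Cmod a + Cmod b <= B.
Proof.
intros H.
destruct (classic (a = RtoC 0)) as [->|Ha].
{ specialize (H 1 Cmod_1). rewrite Cplus_0_l, Cmult_1_l in H. rewrite Cmod_0. lra. }
destruct (classic (b = RtoC 0)) as [->|Hb].
{ specialize (H 1 Cmod_1). rewrite Cmult_0_r, Cplus_0_r in H. rewrite Cmod_0. lra. }
assert (Ha' := proj1 (Cmod_gt_0 a) Ha). assert (Hb' := proj1 (Cmod_gt_0 b) Hb).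
assert (Ha2 : RtoC (Cmod a) <> RtoC 0) by (intros E; apply RtoC_inj in E; lra).
specialize (H (a / b * RtoC (Cmod b / Cmod a))%C).
rewrite Cmod_mult, Cmod_div, Cmod_R, Rabs_pos_eq in H
  by (try exact Hb; apply Rdiv_le_0_compat; lra).
specialize (H ltac:(field; lra)).
replace (a + a / b * RtoC (Cmod b / Cmod a) * b)%C
  with (a * RtoC (1 + Cmod b / Cmod a))%C in H.
- assert (0 <= Cmod b / Cmod a) by (apply Rdiv_le_0_compat; lra).
  rewrite Cmod_mult, Cmod_R, Rabs_pos_eq in H by lra.
  replace (Cmod a + Cmod b) with (Cmod a * (1 + Cmod b / Cmod a)) by (field; lra). exact H.
- rewrite RtoC_plus. field. exact Hb.
Qed.

(** These weights are nonnegative with mean 2, so averaging against them at most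
    doubles a bound. *)
Lemma fejer_weight (u : C) : Cmod u = 1 -> Cmod (2 + u + Cconj u) = 2 + 2 * fst u.
Proof.
intros Hu. assert (A := re_le_Cmod u). rewrite Hu in A. apply Rabs_le_between in A.
unfold Re in A. replace (2 + u + Cconj u)%C with (RtoC (2 + 2 * fst u)).
- rewrite Cmod_R, Rabs_pos_eq; lra.
- unfold RtoC, Cplus, Cconj. simpl. f_equal; ring.
Qed.

Lemma fst_csum (F : nat -> C) (n : nat) : fst (csum F n) = rsum (fun l => fst (F l)) n.
Proof. induction n as [|n IH]; simpl; [reflexivity|now rewrite IH]. Qed.

(** Averaging the polynomial on [|z| = r] against [y^n (2 + v y^d + conj(v) x^d)],
    where [x] runs over roots of unity of high order, [y = conj(x)] and [d = m - n],
    picks the coefficients of orders [n], [m] and [n - d], the last of which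
    vanishes. *)
Lemma kernel_coefficients (c : nat -> C) (k n m : nat) (r B : R) (v : C) :
  0 <= r -> (n < m < k)%nat -> (forall l, (l < n)%nat -> c l = RtoC 0) ->
  (forall z, Cmod z = r -> Cmod (jet c k z) <= B) -> Cmod v = 1 ->
  Cmod (2 * c n * RtoC r ^ n + v * (c m * RtoC r ^ m)) <= 2 * B.
Proof.
intros Hr [Hnm Hmk] Hlow HB Hv.
(* All exponents that occur differ by less than [k + m]. *)
set (N := (k + m + 1)%nat). assert (HN : 0 < INR N) by (apply lt_0_INR; unfold N; lia).
destruct (orthogonal_roots N ltac:(unfold N; lia)) as (zeta & Hz & Hsum).
pose (x := fun j => (zeta ^ j)%C). pose (y := fun j => Cconj (zeta ^ j)).
assert (Hx : forall j, Cmod (x j) = 1) by (intros; unfold x; rewrite Cmod_pow, Hz; apply pow1).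
assert (Hy : forall j, Cmod (y j) = 1) by (intros; unfold y; rewrite Cmod_conj; apply Hx).
set (d := (m - n)%nat).
pose (u := fun j => (v * y j ^ d)%C).
assert (Hu : forall j, Cmod (u j) = 1).
{ intros j. unfold u. rewrite Cmod_mult, Cmod_pow, Hy, Hv, pow1. ring. }
assert (Huc : forall j, Cconj (u j) = (Cconj v * x j ^ d)%C).
{ intros j. unfold u, y, x. now rewrite Cmult_conj, Cpow_conj, Cconj_conj. }
set (W := csum (fun j => (y j ^ n * (2 + u j + Cconj (u j)) * jet c k (RtoC r * x j))%C) N).
assert (HW1 : Cmod W <= INR N * (2 * B)).
{ unfold W. eapply Rle_trans; [apply Cmod_csum|].
  apply Rle_trans with (rsum (fun j => B * (2 + 2 * fst (u j))) N).
  - apply rsum_le. intros j _.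
    rewrite !Cmod_mult, Cmod_pow, Hy, pow1, fejer_weight, Rmult_1_l by apply Hu.
    rewrite (Rmult_comm B). apply Rmult_le_compat_l.
    + rewrite <- fejer_weight by apply Hu. apply Cmod_ge_0.
    + apply HB. rewrite Cmod_mult, Hx, Cmod_R, Rabs_pos_eq; lra.
  - rewrite rsum_scal, rsum_plus, rsum_const, rsum_scal, <- fst_csum.
    replace (csum u N) with (RtoC 0); [simpl; lra|].
    unfold u. rewrite csum_scal.
    rewrite (csum_ext _ (fun j => ((zeta ^ j) ^ 0 * Cconj (zeta ^ j) ^ d)%C)).
    + rewrite Hsum by (unfold N, d; lia).
      destruct (Nat.eq_dec 0 d) as [E|_]; [unfold d in E; lia|ring].
    + intros j _. unfold y. simpl. ring. }
assert (HW2 : W = (RtoC (INR N) * (2 * c n * RtoC r ^ n + v * (c m * RtoC r ^ m)))%C).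
{ unfold W, jet.
  rewrite (csum_ext _ (fun j => csum (fun l => (c l * RtoC r ^ l *
     (2 * (x j ^ l * y j ^ n) + v * (x j ^ l * y j ^ m) + Cconj v * (x j ^ (l + d) * y j ^ n)))%C) k)).
  2:{ intros j _. rewrite <- csum_scal. apply csum_ext. intros l _. rewrite Huc. unfold u.
      replace m with (d + n)%nat at 1 by (unfold d; lia).
      rewrite !Cpow_add_r, Cpow_mult_l. ring. }
  rewrite csum_swap.
  rewrite (csum_ext _ (fun l =>
     ((if Nat.eq_dec l n then RtoC (INR N) * (2 * c l * RtoC r ^ l) else 0) +
     (if Nat.eq_dec l m then RtoC (INR N) * (v * (c l * RtoC r ^ l)) else 0))%C)).
  - rewrite csum_plus.
    rewrite (csum_single _ k n) by
      first [lia|intros l _ Hl; destruct (Nat.eq_dec l n); [contradiction|reflexivity]].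
    rewrite (csum_single _ k m) by
      first [lia|intros l _ Hl; destruct (Nat.eq_dec l m); [contradiction|reflexivity]].
    destruct (Nat.eq_dec n n) as [_|F]; [|now elim F].
    destruct (Nat.eq_dec m m) as [_|F]; [|now elim F]. ring.
  - intros l Hl. rewrite csum_scal, !csum_plus, !csum_scal. unfold x, y.
    rewrite !Hsum by (unfold N, d; lia).
    destruct (Nat.eq_dec (l + d) n) as [E|_].
    + rewrite Hlow by (unfold d in E; lia).
      destruct (Nat.eq_dec l n), (Nat.eq_dec l m); ring.
    + destruct (Nat.eq_dec l n), (Nat.eq_dec l m); ring. }
rewrite HW2, Cmod_mult, Cmod_R, Rabs_pos_eq in HW1 by lra.
now apply Rmult_le_reg_l with (INR N).
Qed.

Lemma bernoulli_ineq (t : R) (m : nat) : 0 <= t <= 1 -> 1 - INR m * t <= (1 - t) ^ m.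
Proof.
intros Ht. induction m as [|m IH]; [simpl; lra|].
rewrite S_INR. simpl. assert (0 <= INR m) by apply pos_INR.
assert (A := Rmult_le_compat_l (1 - t) _ _ ltac:(lra) IH).
assert (0 <= INR m * (t * t)) by nra. nra.
Qed.

(** An inequality of Caratheodory type: when the leading coefficient of a function
    bounded by 1 is close to the unit circle, all later ones are small.  It is the
    limit of [kernel_coefficients] for Taylor polynomials on circles tending to the
    unit circle, with [v] rotated so that the two terms add up. *)
Lemma bounded_coefficients (g : C -> C) (c : nat -> C) (n m : nat) :
  expandable_in_disc g -> taylor c g -> (forall z, unit_disc z -> Cmod (g z) <= 1) ->
  (forall l, (l < n)%nat -> c l = RtoC 0) -> (n < m)%nat ->
  Cmod (c m) <= 2 * (1 - Cmod (c n)).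
Proof.
intros Hg Hc Hb Hlow Hnm.
set (X := 2 * Cmod (c n) + Cmod (c m)).
assert (H1 := Cmod_ge_0 (c n)). assert (H2 := Cmod_ge_0 (c m)).
assert (HX : 0 <= X) by (unfold X; lra).
assert (Hr : forall r, 0 < r < 1 -> X * r ^ m <= 2).
{ intros r Hr.
  apply Rle_trans with (Cmod (2 * c n * RtoC r ^ n) + Cmod (c m * RtoC r ^ m)).
  { rewrite !Cmod_mult, !Cmod_pow, !Cmod_R, !Rabs_pos_eq by lra.
    assert (Hp : r ^ m <= r ^ n).
    { replace m with (n + (m - n))%nat by lia. rewrite pow_add.
      assert (A : 0 <= r ^ n) by (apply pow_le; lra).
      assert (B : r ^ (m - n) <= 1) by (rewrite <- (pow1 (m - n)); apply pow_incr; lra).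
      nra. }
    unfold X. nra. }
  apply Cmod_align. intros v Hv. apply Rle_plus_epsilon. intros eps Heps.
  set (s := (1 + r) / 2). assert (Hs : r < s < 1) by (unfold s; lra).
  destruct (remainder_bound c g s ltac:(lra) Hg Hc) as (M & HM & H).
  assert (Hq : 0 <= r / s < 1).
  { split; [apply Rdiv_le_0_compat; lra|]. apply Rlt_div_l; lra. }
  destruct (geometric_small M _ (eps / 2) HM Hq ltac:(lra)) as [K HK].
  replace (2 + eps) with (2 * (1 + eps / 2)) by field.
  apply (kernel_coefficients c (K + m + 1)); [lra|lia|exact Hlow| |exact Hv].
  intros z Hz. specialize (H (K + m + 1)%nat z ltac:(lra)). rewrite Hz in H.
  specialize (HK (K + m + 1)%nat ltac:(lia)).
  assert (B := Hb z ltac:(unfold unit_disc; lra)).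
  replace (jet c (K + m + 1) z) with (g z - (g z - jet c (K + m + 1) z))%C by ring.
  eapply Rle_trans; [apply Cmod_triangle_minus|]. lra. }
assert (X - 2 <= 0); [|unfold X in *; lra].
apply small_is_zero with (X * INR m) 1; [lra|]. intros t Ht.
specialize (Hr (1 - t) ltac:(lra)). assert (A := bernoulli_ineq t m ltac:(lra)). nra.
Qed.

(** * Powers and composition *)

Fixpoint cpow (p : nat -> C) (n : nat) : nat -> C :=
  match n with
  | O => fun l => match l with O => RtoC 1 | S _ => RtoC 0 end
  | S m => conv p (cpow p m)
  end.

Lemma has_jet_pow (N : nat) (p : nat -> C) (f : C -> C) (n : nat) :
  has_jet N p f -> has_jet N (cpow p n) (fun w => (f w ^ n)%C).
Proof.
intros H. induction n as [|n IH]; [exact (taylor_const 1 N)|].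
exact (has_jet_mult _ _ _ _ _ H IH).
Qed.

Lemma conv_zero_r (a b : nat -> C) (l : nat) :
  (forall j, (j <= l)%nat -> b j = RtoC 0) -> conv a b l = RtoC 0.
Proof.
revert a. induction l as [|l IH]; intros a H; simpl.
- rewrite H by lia. ring.
- rewrite H by lia. rewrite IH by (intros; apply H; lia). ring.
Qed.

Lemma cpow_order (p : nat -> C) (n l : nat) :
  p O = RtoC 0 -> (l < n)%nat -> cpow p n l = RtoC 0.
Proof.
intros Hp. revert l. induction n as [|n IH]; intros l Hl; [lia|].
destruct l as [|l]; simpl; rewrite Hp; [ring|].
rewrite conv_zero_r by (intros; apply IH; lia). ring.
Qed.

(** As [phi w = O(w)], replacing [h] by its Taylor polynomial of order [N] costs
    only [O(w^N)], and a polynomial in [phi] is a combination of its powers. *)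
Lemma has_jet_comp (N : nat) (b p : nat -> C) (h phi : C -> C) :
  p O = RtoC 0 -> has_jet N b h -> has_jet N p phi -> has_jet 1 p phi ->
  has_jet N (fun l => csum (fun n => (b n * cpow p n l)%C) N) (fun w => h (phi w)).
Proof.
intros Hp0 (K & d & HK & Hd & H) Hphi (L & d' & HL & Hd' & H').
assert (Herr : has_jet N (fun _ => RtoC 0) (fun w => (h (phi w) - jet b N (phi w))%C)).
{ assert (Hm : 0 < Rmin d' (d / (L + 1))).
  { apply Rmin_pos; [exact Hd'|]. apply Rdiv_lt_0_compat; lra. }
  exists (K * L ^ N), (Rmin d' (d / (L + 1))).
  repeat split; [apply Rmult_le_pos; [exact HK|now apply pow_le]|exact Hm|].
  intros w Hw. assert (A := Rmin_l d' (d / (L + 1))). assert (B := Rmin_r d' (d / (L + 1))).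
  specialize (H' w ltac:(lra)). rewrite jet_first in H'. unfold jet at 1 in H'.
  simpl in H'. rewrite Hp0, Rmult_1_r in H'.
  replace (phi w - (0 + w * 0))%C with (phi w) in H' by ring.
  replace (jet (fun _ => RtoC 0) N w) with (RtoC 0)
    by (symmetry; apply csum_zero; intros; ring).
  replace (h (phi w) - jet b N (phi w) - 0)%C
    with (h (phi w) - jet b N (phi w))%C by ring.
  assert (Hw0 := Cmod_ge_0 w).
  eapply Rle_trans; [apply H|].
  - apply Rle_lt_trans with ((L + 1) * Cmod w); [nra|].
    replace d with ((L + 1) * (d / (L + 1))) by (field; lra).
    apply Rmult_lt_compat_l; lra.
  - rewrite Rmult_assoc, <- Rpow_mult_distr. apply Rmult_le_compat_l; [exact HK|].
    apply pow_incr. split; [apply Cmod_ge_0|exact H']. }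
eapply has_jet_ext; [| |exact (has_jet_plus _ _ _ _ _ Herr
  (has_jet_csum N N (fun n l => (b n * cpow p n l)%C) (fun n w => (b n * phi w ^ n)%C)
    (fun n _ => has_jet_scal N (b n) _ _ (has_jet_pow N p phi n Hphi))))].
- intros l _. cbv beta. apply Cplus_0_l.
- intros w. cbv beta. unfold jet. ring.
Qed.

(** * The majorant inequality *)

(** The full series sums to [1 / (1 - r)^2]. *)
Lemma weighted_geometric_le (r : R) (n : nat) :
  0 <= r <= 1 -> 2 <= 3 * (1 - r) ^ 2 ->
  rsum (fun l => INR (l + 1) * r ^ l) n <= 3 / 2.
Proof.
intros [Hr Hr1] H.
assert (E : (1 - r) ^ 2 * rsum (fun l => INR (l + 1) * r ^ l) n
  = 1 - INR (n + 1) * r ^ n + INR n * r ^ (n + 1)).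
{ induction n as [|n IH]; [simpl; ring|].
  cbn [rsum]. rewrite Rmult_plus_distr_l, IH.
  replace (S n + 1)%nat with (S (S n)) by lia. replace (n + 1)%nat with (S n) by lia.
  rewrite !S_INR. simpl. ring. }
assert (Hle : INR n * r ^ (n + 1) <= INR (n + 1) * r ^ n).
{ rewrite plus_INR, pow_add. simpl. assert (A := pow_le r n Hr). assert (B := pos_INR n).
  assert (INR n * (r ^ n * (r * 1)) <= INR n * (r ^ n * 1)).
  { apply Rmult_le_compat_l; [exact B|]. apply Rmult_le_compat_l; lra. }
  nra. }
nra.
Qed.

(** Applied to the moduli of the coefficients of [phi^(n+1)], shifted by one index
    through differentiation, which is why [gamma] starts at [n]. *)
Lemma power_majorant (gamma : nat -> R) (alpha r : R) (n k : nat) :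
  (n < k)%nat -> 0 <= r <= 1 -> 2 <= 3 * (1 - r) ^ 2 -> 0 <= alpha <= 1 ->
  (forall l, (l < n)%nat -> gamma l = 0) -> gamma n = alpha ->
  (forall l, (n < l)%nat -> gamma l <= 2 * (1 - alpha)) ->
  rsum (fun l => INR (S l) * gamma l * r ^ l) k <= INR (S n) * r ^ n.
Proof.
intros Hn Hr Hr2 Ha Hlow Hmid Hhigh.
set (j := (k - S n)%nat).
replace k with (n + (1 + j))%nat by (unfold j; lia).
rewrite !rsum_split.
rewrite (rsum_ext _ (fun _ => 0) n) by (intros l Hl; rewrite Hlow by exact Hl; ring).
rewrite rsum_const, Rmult_0_r, Rplus_0_l. cbn [rsum]. rewrite Nat.add_0_r, Hmid.
assert (Hrn : 0 <= r ^ n) by (apply pow_le; lra).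
assert (HSn : 0 < INR (S n)) by (apply lt_0_INR; lia).
assert (Hw := weighted_geometric_le r (1 + j) Hr Hr2).
rewrite rsum_split in Hw. cbn [rsum] in Hw. simpl (0 + 1)%nat in Hw.
simpl (r ^ 0) in Hw. rewrite INR_1 in Hw.
set (S0 := rsum (fun l => INR (1 + l + 1) * r ^ (1 + l)) j) in Hw.
apply Rle_trans with (INR (S n) * alpha * r ^ n + INR (S n) * r ^ n * (2 * (1 - alpha)) * S0).
- rewrite Rplus_0_l. apply Rplus_le_compat_l. unfold S0. rewrite <- rsum_scal.
  apply rsum_le. intros l _.
  rewrite pow_add.
  assert (Hrl : 0 <= r ^ (1 + l)) by (apply pow_le; lra).
  assert (HI : INR (S (n + (1 + l))) <= INR (S n) * INR (1 + l + 1)).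
  { rewrite <- mult_INR. apply le_INR. nia. }
  assert (HI0 := pos_INR (S (n + (1 + l)))).
  specialize (Hhigh (n + (1 + l))%nat ltac:(lia)).
  apply Rle_trans with (INR (S (n + (1 + l))) * (2 * (1 - alpha)) * (r ^ n * r ^ (1 + l))).
  + apply Rmult_le_compat_r; [now apply Rmult_le_pos|]. now apply Rmult_le_compat_l.
  + replace (INR (S n) * r ^ n * (2 * (1 - alpha)) * (INR (1 + l + 1) * r ^ (1 + l)))
      with (INR (S n) * INR (1 + l + 1) * (2 * (1 - alpha)) * (r ^ n * r ^ (1 + l))) by ring.
    apply Rmult_le_compat_r; [now apply Rmult_le_pos|].
    apply Rmult_le_compat_r; lra.
- assert (A : 0 <= INR (S n) * r ^ n * (2 * (1 - alpha))).
  { apply Rmult_le_pos; [apply Rmult_le_pos; lra|lra]. }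
  assert (B := Rmult_le_compat_l _ S0 (1 / 2) A ltac:(lra)). nra.
Qed.

(** The coefficients of [f] are combinations of those of the powers of [phi] with
    weights [b n]; after exchanging the sums, [power_majorant] handles each power. *)
Lemma subordinate_majorant (f h phi : C -> C) (a b : nat -> C) (k : nat) (r : R) :
  expandable_in_disc phi -> (forall z, unit_disc z -> unit_disc (phi z)) ->
  phi (RtoC 0) = RtoC 0 -> (forall z, unit_disc z -> f z = h (phi z)) ->
  taylor a f -> taylor b h -> 0 <= r <= 1 -> 2 <= 3 * (1 - r) ^ 2 ->
  rsum (fun l => INR (S l) * Cmod (a (S l)) * r ^ l) k <=
  rsum (fun l => INR (S l) * Cmod (b (S l)) * r ^ l) k.
Proof.
intros Hphi Hdisc H0 Hf Ha Hb Hr Hr2.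
destruct (Hphi (RtoC 0)) as [p Hp]; [unfold unit_disc; rewrite Cmod_0; lra|].
apply taylor_at_0 in Hp.
assert (Hp0 : p O = RtoC 0) by now rewrite <- (taylor_value _ _ Hp).
assert (Hcomp := has_jet_comp (S k) b p h phi Hp0 (Hb _) (Hp _) (Hp _)).
assert (Hcoef : forall l, (l < k)%nat ->
  a (S l) = csum (fun n => (b (S n) * cpow p (S n) (S l))%C) k).
{ intros l Hl.
  apply (has_jet_local (S k) _ _ f 1 Rlt_0_1) in Hcomp;
    [|intros w Hw; symmetry; now apply Hf].
  rewrite (has_jet_unique _ _ _ _ (Ha _) Hcomp) by lia.
  rewrite csum_first. simpl. ring. }
assert (Hpow : forall n, taylor (cpow p n) (fun w => (phi w ^ n)%C)).
{ intros n N. apply has_jet_pow, Hp. }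
assert (Hpowe : forall n, expandable_in_disc (fun w => (phi w ^ n)%C)).
{ intros n z Hz. now apply expandable_pow, Hphi. }
assert (Hbd : forall n z, unit_disc z -> Cmod (phi z ^ n) <= 1).
{ intros n z Hz. rewrite Cmod_pow, <- (pow1 n). apply pow_incr.
  split; [apply Cmod_ge_0|]. left. now apply Hdisc. }
assert (Hhigh : forall n l, (n < l)%nat -> Cmod (cpow p n l) <= 2 * (1 - Cmod (cpow p n n))).
{ intros n l Hl. apply (bounded_coefficients (fun w => (phi w ^ n)%C)); auto.
  intros i Hi. now apply cpow_order. }
apply Rle_trans with (rsum (fun l => rsum (fun n =>
  Cmod (b (S n)) * (INR (S l) * Cmod (cpow p (S n) (S l)) * r ^ l)) k) k).
- apply rsum_le. intros l Hl. rewrite Hcoef by exact Hl.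
  rewrite (rsum_ext _ (fun n => INR (S l) * r ^ l * Cmod (b (S n) * cpow p (S n) (S l)))).
  + rewrite rsum_scal.
    assert (A := Cmod_csum (fun n => (b (S n) * cpow p (S n) (S l))%C) k).
    assert (B : 0 <= INR (S l) * r ^ l).
    { apply Rmult_le_pos; [apply pos_INR|apply pow_le; lra]. }
    assert (D := Rmult_le_compat_l _ _ _ B A). lra.
  + intros n _. rewrite Cmod_mult. ring.
- rewrite rsum_swap. apply rsum_le. intros n Hn. rewrite rsum_scal.
  replace (INR (S n) * Cmod (b (S n)) * r ^ n)
    with (Cmod (b (S n)) * (INR (S n) * r ^ n)) by ring.
  apply Rmult_le_compat_l; [apply Cmod_ge_0|].
  assert (A := Hhigh (S n) (S (S n)) ltac:(lia)).
  assert (B := Cmod_ge_0 (cpow p (S n) (S (S n)))).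
  apply (power_majorant (fun l => Cmod (cpow p (S n) (S l))) (Cmod (cpow p (S n) (S n))));
    [exact Hn|exact Hr|exact Hr2| | |reflexivity|].
  + split; [apply Cmod_ge_0|lra].
  + intros l Hl. rewrite cpow_order by (try exact Hp0; lia). apply Cmod_0.
  + intros l Hl. apply Hhigh. lia.
Qed.

(** * Sections and the Bohr operator *)

Lemma section_jet (k : nat) (g : C -> C) (z : C) :
  section k g z = jet (coeff g) (S k) z.
Proof.
unfold section. induction k as [|k IH].
- rewrite sum_O. unfold jet. simpl. ring.
- rewrite sum_Sn, IH, (jet_S _ (S k)). reflexivity.
Qed.

Definition truncate (k : nat) (c : nat -> C) (n : nat) : C :=
  if le_dec n k then c n else RtoC 0.

Lemma jet_truncate (c : nat -> C) (k n : nat) (z : C) :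
  (k < n)%nat -> jet (truncate k c) n z = jet c (S k) z.
Proof.
induction 1 as [|n Hn IH].
- apply jet_ext. intros l Hl. unfold truncate. destruct (le_dec l k); [reflexivity|lia].
- rewrite jet_S, IH. unfold truncate. destruct (le_dec n k); [lia|ring].
Qed.

Lemma coeff_section (k : nat) (g : C -> C) : coeff (section k g) = truncate k (coeff g).
Proof.
apply coeff_unique. intros z _. apply is_pseries_jet. intros eps Heps.
exists (S k). intros n Hn. rewrite jet_truncate, section_jet by exact Hn.
unfold Cminus. now rewrite Cplus_opp_r, Cmod_0.
Qed.

Lemma bohr_section (r : R) (k : nat) (g : C -> C) :
  bohr r (section k g) = rsum (fun n => Cmod (coeff g n) * r ^ n) (S k).
Proof.
unfold bohr. rewrite coeff_section. apply is_series_unique.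
apply (filterlim_ext_loc (fun _ => rsum (fun n => Cmod (coeff g n) * r ^ n) (S k)));
  [|apply filterlim_const].
exists k. intros n Hn. symmetry.
assert (E : forall m, sum_n (fun i => Cmod (truncate k (coeff g) i) * r ^ i) m
  = rsum (fun i => Cmod (truncate k (coeff g) i) * r ^ i) (S m)).
{ induction m as [|m IH]; [rewrite sum_O; simpl; ring|].
  rewrite sum_Sn, IH. reflexivity. }
rewrite E. replace (S n) with (S k + (n - k))%nat by lia. rewrite rsum_split.
rewrite (rsum_ext (fun l => Cmod (truncate k (coeff g) (S k + l)) * r ^ (S k + l)) (fun _ => 0)).
- rewrite rsum_const, Rmult_0_r, Rplus_0_r. apply rsum_ext. intros l Hl.
  unfold truncate. destruct (le_dec l k); [reflexivity|lia].
- intros l _. unfold truncate. destruct (le_dec (S k + l) k); [lia|]. rewrite Cmod_0. ring.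
Qed.

Lemma Cmod_section_le_bohr (k : nat) (g : C -> C) (z : C) :
  Cmod (section k g z) <= bohr (Cmod z) (section k g).
Proof. rewrite section_jet, bohr_section. apply Cmod_jet_le. Qed.

Lemma analytic_derive_coeff (g : C -> C) :
  analytic_on unit_disc g -> exists c, taylor c g /\
    coeff (C_derive g) = (fun l => (RtoC (INR (S l)) * c (S l))%C).
Proof.
intros H. apply analytic_expandable in H.
destruct (H (RtoC 0)) as [c Hc]; [unfold unit_disc; rewrite Cmod_0; lra|].
apply taylor_at_0 in Hc. exists c. split; [exact Hc|].
now apply coeff_unique, derive_disc_expansion.
Qed.

(** The condition on [r] is [2 <= 3 (1 - r)^2], under which [weighted_geometric_le]
    gives room for the factor 2 of [bounded_coefficients]. *)
Lemma bohr_section_derive_le (f h : C -> C) (k : nat) (r : R) :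
  analytic_on unit_disc f -> analytic_on unit_disc h -> subordinate f h ->
  0 <= r <= 1 - sqrt (2 / 3) ->
  bohr r (section k (C_derive f)) <= bohr r (section k (C_derive h)).
Proof.
intros Hf Hh (phi & (Hphi & Hdisc & H0) & E) Hr.
assert (Hs := sqrt_pos (2 / 3)).
assert (Hs2 : sqrt (2 / 3) * sqrt (2 / 3) = 2 / 3) by (apply sqrt_sqrt; lra).
destruct (analytic_derive_coeff f Hf) as (a & Ha & Ea).
destruct (analytic_derive_coeff h Hh) as (b & Hb & Eb).
rewrite !bohr_section, Ea, Eb.
assert (R1 : forall c : nat -> C, rsum (fun n => Cmod (RtoC (INR (S n)) * c (S n)) * r ^ n) (S k)
  = rsum (fun n => INR (S n) * Cmod (c (S n)) * r ^ n) (S k)).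
{ intros c. apply rsum_ext. intros l _.
  rewrite Cmod_mult, Cmod_R, Rabs_pos_eq by apply pos_INR. reflexivity. }
rewrite (R1 a), (R1 b).
apply (subordinate_majorant f h phi); auto.
- now apply analytic_expandable.
- lra.
- nra.
Qed.

Theorem theorem3 (f h : C -> C)
  (hf : analytic_on unit_disc f) (hh : analytic_on unit_disc h)
  (hfh : subordinate f h) (k : nat) :
  (forall (r : R) (z : C),
     0 <= r <= 1 / 2 * (1 - sqrt (2 / 3)) -> Cmod z = r ->
     Cmod (section k (C_derive f) z) <= bohr r (section k (C_derive h))) /\
  (forall r : R,
     0 <= r <= 1 / 3 * (1 - sqrt (2 / 3)) ->
     bohr r (section k (C_derive f)) <= bohr r (section k (C_derive h))).
Proof.
split.
- intros r z Hr <-. eapply Rle_trans; [apply Cmod_section_le_bohr|].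
  apply bohr_section_derive_le; auto. lra.
- intros r Hr. apply bohr_section_derive_le; auto. lra.
Qed.
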